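(* Let $(a_{nk})_{n\ge0,k\in\mathbb Z}$ be complex scalars with $\sum_{k\in\mathbb Z}|a_{nk}|<\infty$ for each $n\ge0$. Then the following are equivalent: (i) $\sum_{k\in\mathbb Z}a_{nk}\hat f(k)e^{ikt}\to f$ weakly in $C(\mathbb T)$, for all $f\in C(\mathbb T)$; (ii) $\sum_{k\in\mathbb Z}a_{nk}\hat f(k)e^{ikt}\to f$ in sup-norm, for all $f\in C(\mathbb T)$; (iii) $\sum_{k\in\mathbb Z}a_{nk}\hat\mu(k)e^{ikt}\,dt/2\pi\to\mu$ weak* in $M(\mathbb T)$, for all $\mu\in M(\mathbb T)$; (iv) $\sum_{k\in\mathbb Z}a_{nk}\hat g(k)e^{ikt}\,dt/2\pi\to g(e^{it})\,dt/2\pi$ weak* in $M(\mathbb T)$, for all $g\in L^1(\mathbb T)$; (v) $\sum_{k\in\mathbb Z}a_{nk}\hat g(k)e^{ikt}\to g$ in $L^1(\mathbb T)$-norm, for all $g\in L^1(\mathbb T)$.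
   Context: $\mathbb T$ is the unit circle, $C(\mathbb T)$ the continuous complex functions with sup-norm, $M(\mathbb T)$ the finite complex Borel measures with total-variation norm, identified with $C(\mathbb T)^*$ via $\langle f,\mu\rangle=\int_{\mathbb T}f(\zeta)\,d\mu(\overline\zeta)$; weak* refers to this duality. $L^1(\mathbb T)$ is identified with absolutely continuous measures via $g\leftrightarrow g(e^{it})dt/2\pi$. Fourier coefficients: $\hat\mu(k)=\int_{\mathbb T}\overline\zeta^k\,d\mu(\zeta)$, $\hat f(k)=\frac1{2\pi}\int_0^{2\pi}f(e^{it})e^{-ikt}dt$. *)

(* Defs.v *)
From HB Require Import structures.
From mathcomp Require Import all_boot all_order all_algebra.
From mathcomp Require Import all_classical all_reals all_analysis.
From mathcomp Require Import complex.
Set Implicit Arguments. Unset Strict Implicit. Unset Printing Implicit Defensive.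
Import Order.TTheory GRing.Theory Num.Theory.
Import numFieldNormedType.Exports.
Local Open Scope classical_set_scope.
Local Open Scope ring_scope.
Local Open Scope complex_scope.

Section Defs.
Variable R : realType.
Local Notation C := R[i].
Local Notation leb := (@lebesgue_measure R).

(* The circle T is parametrized by t |-> e^{it}; a function on T is a
   2pi-periodic function R -> C, t |-> f(e^{it}). *)
Definition cRe (z : C) : R := complex.Re z.
Definition cIm (z : C) : R := complex.Im z.

Definition expi (x : R) : C := Complex (cos x) (sin x).

Definition cabs (z : C) : R := ComplexField.Normc.normc z.

Definition contT (f : R -> C) : Prop :=
  (forall t, f (t + pi *+ 2) = f t) /\
  continuous (fun t => cRe (f t)) /\ continuous (fun t => cIm (f t)).

Definition L1T (g : R -> C) : Prop :=
  leb.-integrable `[0%R, pi *+ 2] (fun t => (cRe (g t))%:E) /\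
  leb.-integrable `[0%R, pi *+ 2] (fun t => (cIm (g t))%:E).

Definition cint (h : R -> C) : C :=
  ((pi *+ 2)^-1 * \int[leb]_(t in `[0%R, pi *+ 2]) cRe (h t))%:C +
  'i * ((pi *+ 2)^-1 * \int[leb]_(t in `[0%R, pi *+ 2]) cIm (h t))%:C.

Definition fhat (f : R -> C) (k : int) : C :=
  cint (fun t => f t * expi (- (k%:~R * t))).

(* Complex Borel measures on T, parametrized by [0,2pi), written through a
   (Jordan-type) decomposition mu = (m1 - m2) + i (m3 - m4) with finite
   positive Borel measures m_j on R concentrated on [0,2pi). *)
Record cmeasure := CMeasure {
  cm1 : {finite_measure set (measurableTypeR R) -> \bar R};
  cm2 : {finite_measure set (measurableTypeR R) -> \bar R};
  cm3 : {finite_measure set (measurableTypeR R) -> \bar R};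
  cm4 : {finite_measure set (measurableTypeR R) -> \bar R};
  cm1_supp : cm1 (~` `[0%R, pi *+ 2[) = 0%E;
  cm2_supp : cm2 (~` `[0%R, pi *+ 2[) = 0%E;
  cm3_supp : cm3 (~` `[0%R, pi *+ 2[) = 0%E;
  cm4_supp : cm4 (~` `[0%R, pi *+ 2[) = 0%E }.

Definition cintm (m : {finite_measure set (measurableTypeR R) -> \bar R})
  (h : R -> C) : C :=
  (\int[m]_(t in setT) cRe (h t))%:C + 'i * (\int[m]_(t in setT) cIm (h t))%:C.

Definition cintmu (mu : cmeasure) (h : R -> C) : C :=
  (cintm (cm1 mu) h - cintm (cm2 mu) h) +
  'i * (cintm (cm3 mu) h - cintm (cm4 mu) h).

Definition muhat (mu : cmeasure) (k : int) : C :=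
  cintmu mu (fun t => expi (- (k%:~R * t))).

(* duality <f, mu> = int f(conj zeta) dmu(zeta) *)
Definition pairM (f : R -> C) (mu : cmeasure) : C :=
  cintmu mu (fun t => f (- t)).

Definition pairL1 (f : R -> C) (h : R -> C) : C :=
  cint (fun t => f (- t) * h t).

Definition symsum (c : int -> C) (N : nat) : C :=
  \sum_(i < N.*2.+1) c (i%:Z - N%:Z).

Definition zsum (c : int -> C) : C :=
  (limn (fun N => cRe (symsum c N)))%:C +
  'i * (limn (fun N => cIm (symsum c N)))%:C.

Definition abssum (c : int -> C) : Prop :=
  exists M : R, forall N : nat,
    \sum_(i < N.*2.+1) cabs (c (i%:Z - N%:Z)) <= M.

Definition Ssum (a : nat -> int -> C) (n : nat) (x : int -> C) : R -> C :=
  fun t => zsum (fun k => a n k * x k * expi (k%:~R * t)).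

Definition ccvg (u : nat -> C) (l : C) : Prop :=
  (fun n => cabs (u n - l)) @ \oo --> (0 : R).

Definition bdd_lin_functional (phi : (R -> C) -> C) : Prop :=
  (forall (c : C) f g, contT f -> contT g ->
      phi (fun t => c * f t + g t) = c * phi f + phi g) /\
  exists M : R, forall f s, contT f -> (forall t, cabs (f t) <= s) ->
      cabs (phi f) <= M * s.

End Defs.

(* Main.v *)
(* Write S_n f for the n-th multiplier sum.  Pairing a multiplier sum with a bounded
   functional only involves the products a_nk L(e_k), so that
   <f, S_n mu> = <S_n f, mu> and <f, S_n g> = <S_n f, g>.  Each of the five conditions
   is equivalent to: a_nk -> 1 for every k, and the operators S_n are uniformly bounded
   on C(T).

   Necessity.  (i) (through the functional f |-> f(0)) and (iii) (with the Dirac mass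
   at 1) give S_n f (0) -> f(0) for all f, so the uniform boundedness principle on C(T)
   and translation invariance bound the S_n.  Under (iv), which (v) implies, the
   principle on L^1 first bounds the sup-norms of S_n f for each fixed f.

   Sufficiency.  By Fejer's theorem the trigonometric polynomials are dense in C(T),
   which yields (ii), and by duality the other weak statements.  The adjoint bound on
   L^1 and the density of C(T) in L^1 yield (v). *)
Require Import Defs.
From HB Require Import structures.
From mathcomp Require Import all_boot all_order all_algebra.
From mathcomp Require Import all_classical all_reals all_analysis.
From mathcomp Require Import measurable_realfun complex.
From mathcomp Require Import ring lra zify.
Import Order.TTheory GRing.Theory Num.Theory.
Import numFieldNormedType.Exports.
Set Implicit Arguments.
Unset Strict Implicit.
Unset Printing Implicit Defensive.
Local Open Scope classical_set_scope.
Local Open Scope ring_scope.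

(** * Complex modulus and symmetric sums *)

Section Complex.
Variable R : realType.
Local Notation C := R[i].
Implicit Types (z w : C) (x y : R).

(** Substitution and Fubini are avoided. A bounded functional on C(T) is determined by its values on
    the characters e_k, so reflection and translation formulas are checked on characters, and the
    duality formulas come down to commuting two factors in a series. Measures enter only as bounded
    functionals.

    The obstacle under (iv) is that it controls pairings with L^1 functions, whereas the bound
    needed is on a value at a point, a pairing with a Dirac mass. Fejer kernels bridge the gap: they
    are nonnegative of mean 1, so their L^1 norm is fixed, and on each continuous S_n f they
    approximate evaluation at the point.

    The uniform boundedness principle is proved by a gliding hump for a ball predicate on plain real
    functions, so that one statement serves both C(T) and L^1 without a quotient by null sets.
    Complex functions are split into real and imaginary parts; the resulting factors 2 and 4 are
    harmless, since only uniformity in n matters. *)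

Lemma cabs_ge0 z : 0 <= cabs z.
Proof. by case: z => x y; rewrite /cabs /= sqrtr_ge0. Qed.

Lemma cabsD z w : cabs (z + w) <= cabs z + cabs w.
Proof. exact: le_normcD. Qed.

Lemma cabsN z : cabs (- z) = cabs z.
Proof. exact: normcN. Qed.

Lemma cabsM z w : cabs (z * w) = cabs z * cabs w.
Proof. exact: ComplexField.Normc.normcM. Qed.

Lemma cabs0 : cabs (0 : C) = 0.
Proof. exact: ComplexField.Normc.normc0. Qed.

Lemma cabs1 : cabs (1 : C) = 1.
Proof. exact: ComplexField.Normc.normc1. Qed.

Lemma cabs_eq0 z : cabs z = 0 -> z = 0.
Proof. exact: ComplexField.Normc.eq0_normc. Qed.

Lemma cabsB z w : cabs (z - w) = cabs (w - z).
Proof. by rewrite -cabsN opprB. Qed.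

Lemma cabs_real x : cabs (x%:C)%C = `|x|.
Proof. by rewrite /cabs /= expr0n /= addr0 sqrtr_sqr. Qed.

Lemma cabs_sum (I : Type) (r : seq I) (P : pred I) (F : I -> C) :
  cabs (\sum_(i <- r | P i) F i) <= \sum_(i <- r | P i) cabs (F i).
Proof.
elim/big_ind2: _ => [|z x w y zx wy|//]; first by rewrite cabs0.
by rewrite (le_trans (cabsD _ _))// lerD.
Qed.

Lemma cRe_le z : `|cRe z| <= cabs z.
Proof.
by case: z => x y; rewrite /cRe /cabs /= -sqrtr_sqr ler_wsqrtr// lerDl sqr_ge0.
Qed.

Lemma cIm_le z : `|cIm z| <= cabs z.
Proof.
by case: z => x y; rewrite /cIm /cabs /= -sqrtr_sqr ler_wsqrtr// lerDr sqr_ge0.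
Qed.

Lemma cabs_le z : cabs z <= `|cRe z| + `|cIm z|.
Proof.
case: z => x y; rewrite /cabs /cRe /cIm /=.
rewrite -(@ger0_norm _ (`|x| + `|y|)) ?addr_ge0// -sqrtr_sqr ler_wsqrtr//.
rewrite -(real_normK (num_real x)) -(real_normK (num_real y)).
by have := mulr_ge0 (normr_ge0 x) (normr_ge0 y); nra.
Qed.

Lemma cReD z w : cRe (z + w) = cRe z + cRe w.
Proof. by case: z; case: w. Qed.
Lemma cImD z w : cIm (z + w) = cIm z + cIm w.
Proof. by case: z; case: w. Qed.
Lemma cReN z : cRe (- z) = - cRe z.
Proof. by case: z. Qed.
Lemma cImN z : cIm (- z) = - cIm z.
Proof. by case: z. Qed.
Lemma cReM z w : cRe (z * w) = cRe z * cRe w - cIm z * cIm w.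
Proof. by case: z; case: w. Qed.
Lemma cImM z w : cIm (z * w) = cRe z * cIm w + cIm z * cRe w.
Proof. by case: z; case: w => ? ? ? ?; rewrite /cIm /cRe /= addrC; congr (_ + _); rewrite mulrC. Qed.

Definition cRI := (cReD, cImD, cReN, cImN, cReM, cImM).

Lemma eqC z w : cRe z = cRe w -> cIm z = cIm w -> z = w.
Proof. by case: z => a b; case: w => c d; rewrite /cRe /cIm /= => -> ->. Qed.

Lemma cabs_expi x : cabs (expi x) = 1.
Proof. by rewrite /cabs /expi /= cos2Dsin2 sqrtr1. Qed.

Lemma expiD x y : expi (x + y) = expi x * expi y.
Proof.
by apply: eqC; rewrite cRI /cRe /cIm /= ?cosD ?sinD // addrC; congr (_ + _); rewrite mulrC.
Qed.

Lemma expi0 : expi 0 = 1 :> C.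
Proof. by rewrite /expi cos0 sin0. Qed.

Lemma ccvgP (u : nat -> C) l : ccvg u l <->
  forall e : R, 0 < e -> exists N, forall n, (N <= n)%N -> cabs (u n - l) <= e.
Proof.
rewrite /ccvg; split.
  move=> /cvgrPdist_le h e e0; have [N _ Nh] := h e e0.
  exists N => n Nn; have := Nh n Nn; rewrite /= sub0r normrN.
  by rewrite ger0_norm// cabs_ge0.
move=> h; apply/cvgrPdist_le => e e0; have [N Nh] := h e e0.
by exists N => // n /= Nn; rewrite sub0r normrN ger0_norm ?cabs_ge0// Nh.
Qed.

Lemma cabs_sub_le z w : (forall e : R, 0 < e -> cabs (z - w) <= e) -> z = w.
Proof.
move=> h; apply/eqP; rewrite -subr_eq0; apply/eqP/cabs_eq0/le_anti.
by rewrite cabs_ge0 andbT; apply/ler_addgt0Pl => e e0; rewrite addr0 h.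
Qed.

Lemma cRe_parts (x y : R) : cRe (x%:C + 'i * y%:C)%C = x.
Proof. by rewrite cRI cReM /cRe /cIm /=; ring. Qed.

Lemma cIm_parts (x y : R) : cIm (x%:C + 'i * y%:C)%C = y.
Proof. by rewrite cRI cImM /cRe /cIm /=; ring. Qed.

End Complex.

(* Both A and y + A are monotone and bounded. *)
Lemma cvgn_dominated (R : realType) (A y : nat -> R) (M : R) : (forall n, A n <= M) ->
  (forall n, `|y n.+1 - y n| <= A n.+1 - A n) -> cvgn y.
Proof.
move=> AM hy.
have Ah n : A n <= A n.+1 by rewrite -subr_ge0; exact: le_trans (normr_ge0 _) (hy n).
have cv : cvgn A.
  by apply: nondecreasing_is_cvgn; [exact/nondecreasing_seqP|exists M => _ [n _ <-]].
have yn n : `|y n - y 0%N| <= A n - A 0%N.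
  elim: n => [|n IH]; first by rewrite !subrr normr0.
  have := hy n; rewrite (_ : y n.+1 - y 0%N = (y n.+1 - y n) + (y n - y 0%N)); last by ring.
  have := ler_normD (y n.+1 - y n) (y n - y 0%N); lra.
have cv2 : cvgn (y \+ A).
  apply: nondecreasing_is_cvgn.
    apply/nondecreasing_seqP => n /=; have := hy n; rewrite ler_norml; lra.
  exists (M + M - A 0%N + `|y 0%N|) => _ [n _ <-] /=.
  have := AM n; have := yn n; rewrite ler_norml.
  have := ler_norm (y 0%N); lra.
rewrite (_ : y = (y \+ A) \- A); first exact: is_cvgB.
by apply/funext => n /=; rewrite addrK.
Qed.

Section SymmetricSums.
Variable R : realType.
Local Notation C := R[i].
Implicit Types (c d : int -> C).

(** The partial sums that [abssum] requires to be bounded. *)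
Definition asum c N : R := \sum_(i < N.*2.+1) cabs (c (i%:Z - N%:Z)).

Lemma symsum_recr (V : zmodType) (c : int -> V) N :
  \sum_(i < N.+1.*2.+1) c (i%:Z - N.+1%:Z) =
  c (- N.+1%:Z) + \sum_(i < N.*2.+1) c (i%:Z - N%:Z) + c N.+1%:Z.
Proof.
rewrite doubleS big_ord_recr big_ord_recl /=; congr (_ + _ + _).
- by rewrite sub0r.
- apply: eq_bigr => i _; congr c; rewrite /bump /= add1n.
  by rewrite -(addn1 i) -(addn1 N) !PoszD; ring.
- congr c; rewrite -addnn -(addn1 N) -addn2 -?(addn1 N) !PoszD; ring.
Qed.

(** The recursion is proved in any [zmodType] so that it covers the complex sums here and the real
    sums of moduli next. *)
Lemma symsumS c N :
  symsum c N.+1 = c (- N.+1%:Z) + symsum c N + c N.+1%:Z.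
Proof. exact: symsum_recr. Qed.

Lemma asumS c N :
  asum c N.+1 = cabs (c (- N.+1%:Z)) + asum c N + cabs (c N.+1%:Z).
Proof. exact: (symsum_recr (fun k => cabs (c k))). Qed.

Lemma symsumB_le c d N M : (forall k, cabs (d k) <= cabs (c k)) ->
  (N <= M)%N -> cabs (symsum d M - symsum d N) <= asum c M - asum c N.
Proof.
move=> dc; elim: M => [|M IH]; first by rewrite leqn0 => /eqP ->; rewrite !subrr cabs0.
rewrite leq_eqVlt => /predU1P[->|]; first by rewrite !subrr cabs0.
rewrite ltnS => /IH{}IH; rewrite symsumS asumS.
rewrite (_ : _ - _ = d (- M.+1%:Z) + (symsum d M - symsum d N) + d M.+1%:Z); last by ring.
have h1 := cabsD (d (- M.+1%:Z) + (symsum d M - symsum d N)) (d M.+1%:Z).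
have h2 := cabsD (d (- M.+1%:Z)) (symsum d M - symsum d N).
have := dc (- M.+1%:Z); have := dc M.+1%:Z; lra.
Qed.

Lemma asum_homo c N M : (N <= M)%N -> asum c N <= asum c M.
Proof.
move=> NM; rewrite -subr_ge0.
exact: le_trans (cabs_ge0 _) (symsumB_le (fun k => lexx (cabs (c k))) NM).
Qed.

Lemma asum_tail c : abssum c -> forall e : R, 0 < e ->
  exists N, forall m n, (N <= m)%N -> (m <= n)%N -> asum c n - asum c m <= e.
Proof.
move=> [M cM] e e0.
have cv : cvgn (asum c).
  apply: nondecreasing_is_cvgn; first by move=> n m; exact: asum_homo.
  by exists M => _ [n _ <-]; exact: cM.
move/cvgrPdist_le: cv => /(_ (e / 2)) []; first by rewrite divr_gt0.
move=> N _ h; exists N => m n Nm mn.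
have := h m Nm; have := h n (leq_trans Nm mn) => /=.
by rewrite !ler_norml; lra.
Qed.

(** This is the Weierstrass test: [N] is chosen before the dominated family [d]. With d_k = c_k
    e_k(t) the convergence is therefore uniform in t. *)
Lemma zsum_tail c : abssum c -> forall e : R, 0 < e -> exists N,
  forall d, (forall k, cabs (d k) <= cabs (c k)) ->
  forall n, (N <= n)%N -> cabs (zsum d - symsum d n) <= e.
Proof.
move=> hc e e0; have [N hN] := asum_tail hc (divr_gt0 e0 (ltr0n _ 2)).
exists N => d dc n Nn.
(* [p] is the real or the imaginary part. Convergence has to be established first, since [limn] says
   nothing about a divergent sequence. *)
have key (p : C -> R) (pB : forall z w, p (z - w) = p z - p w)
    (ple : forall z, `|p z| <= cabs z) :
    `|limn (fun N => p (symsum d N)) - p (symsum d n)| <= e / 2.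
  have cv : cvgn (fun N => p (symsum d N)).
    have [M cM] := hc; apply: (cvgn_dominated (A := asum c) cM) => m; rewrite -pB (le_trans (ple _))//.
    exact: symsumB_le.
  have hd m : (n <= m)%N -> `|p (symsum d m) - p (symsum d n)| <= e / 2.
    move=> nm; rewrite -pB (le_trans (ple _))// (le_trans (symsumB_le dc nm))//.
    exact: hN.
  rewrite ler_norml lerBDr lerBlDr.
  apply/andP; split; [apply: limr_ge => //|apply: limr_le => //];
    exists n => // m /= /hd; rewrite ler_norml; lra.
rewrite (le_trans (cabs_le _))//.
have h1 := key (@cRe R) (fun z w => ltac:(by rewrite !cRI)) (@cRe_le R).
have h2 := key (@cIm R) (fun z w => ltac:(by rewrite !cRI)) (@cIm_le R).
have -> : cRe (zsum d - symsum d n) = limn (fun N => cRe (symsum d N)) - cRe (symsum d n).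
  by rewrite cReD cReN cRe_parts.
have -> : cIm (zsum d - symsum d n) = limn (fun N => cIm (symsum d N)) - cIm (symsum d n).
  by rewrite cImD cImN cIm_parts.
lra.
Qed.

Lemma zsum_unique c l : abssum c ->
  (forall e : R, 0 < e -> exists N, forall n, (N <= n)%N -> cabs (l - symsum c n) <= e) ->
  zsum c = l.
Proof.
move=> hc hl; apply: cabs_sub_le => e e0.
have e20 : 0 < e / 2 by rewrite divr_gt0.
have [N hN] := zsum_tail hc e20; have [M hM] := hl _ e20.
have := hN c (fun=> lexx _) _ (leq_maxl N M); have := hM _ (leq_maxr N M).
set s := symsum c _; rewrite (_ : zsum c - l = (zsum c - s) - (l - s)); last by ring.
have := cabsD (zsum c - s) (- (l - s)); rewrite cabsN; lra.
Qed.

Lemma asumM c (x : int -> C) X : (forall k, cabs (x k) <= X) ->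
  forall N, asum (fun k => c k * x k) N <= asum c N * X.
Proof.
move=> xX N; rewrite /asum mulr_suml; apply: ler_sum => i _.
by rewrite cabsM ler_wpM2l ?cabs_ge0.
Qed.

Lemma abssumM c (x : int -> C) X : (forall k, cabs (x k) <= X) ->
  abssum c -> abssum (fun k => c k * x k).
Proof.
move=> xX [M cM]; exists (M * X) => N; apply: (le_trans (asumM c xX N)).
by rewrite ler_wpM2r ?cM// (le_trans (cabs_ge0 (x 0))).
Qed.

End SymmetricSums.

(** * Continuous periodic functions and integrals over the circle *)

Section ContinuousPeriodic.
Variable R : realType.
Local Notation C := R[i].
Local Notation T := (pi *+ 2 : R).
Implicit Types (u v : R -> R) (f g : R -> C).

Definition contR u := (forall t, u (t + T) = u t) /\ continuous u.

Lemma T_gt0 : 0 < T.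
Proof. by rewrite mulrn_wgt0 ?pi_gt0. Qed.

Lemma contTE f : contT f <-> contR (fun t => cRe (f t)) /\ contR (fun t => cIm (f t)).
Proof.
split=> [[p [c1 c2]]|[[p1 c1] [p2 c2]]].
  by split; split => // t; rewrite p.
by split => // t; apply: eqC; [exact: p1|exact: p2].
Qed.

Lemma contT_Re f : contT f -> contR (fun t => cRe (f t)).
Proof. by case/contTE. Qed.

Lemma contT_Im f : contT f -> contR (fun t => cIm (f t)).
Proof. by case/contTE. Qed.

Lemma contR_cst (x : R) : contR (fun=> x).
Proof. by split => // t; exact: cvg_cst. Qed.

Lemma contRD u v : contR u -> contR v -> contR (fun t => u t + v t).
Proof. by move=> [pu cu] [pv cv]; split => t; [rewrite pu pv|apply: cvgD; [exact: cu|exact: cv]]. Qed.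

Lemma contRM u v : contR u -> contR v -> contR (fun t => u t * v t).
Proof. by move=> [pu cu] [pv cv]; split => t; [rewrite pu pv|apply: cvgM; [exact: cu|exact: cv]]. Qed.

Lemma contRN u : contR u -> contR (fun t => - u t).
Proof. by move=> [pu cu]; split => t; [rewrite pu|apply: cvgN; exact: cu]. Qed.

Lemma contRB u v : contR u -> contR v -> contR (fun t => u t - v t).
Proof. by move=> hu hv; apply: contRD => //; exact: contRN. Qed.

Lemma contR_norm u : contR u -> contR (fun t => `|u t|).
Proof. by move=> [pu cu]; split => t; [rewrite pu|apply: cvg_norm; exact: cu]. Qed.

Lemma contR_inv u : contR u -> (forall t, u t != 0) -> contR (fun t => (u t)^-1).
Proof. by move=> [pu cu] u0; split => t; [rewrite pu|apply: cvgV => //; exact: cu]. Qed.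

Lemma contR_shift u a : contR u -> contR (fun t => u (t + a)).
Proof.
move=> [pu cu]; split => t; first by rewrite addrAC pu.
apply: (@continuous_comp _ _ _ (fun t => t + a) u); last exact: cu.
by apply: cvgD; [exact: cvg_id|exact: cvg_cst].
Qed.

Lemma contR_opp u : contR u -> contR (fun t => u (- t)).
Proof.
move=> [pu cu]; split => t; first by rewrite opprD -(pu (- t - T)) subrK.
by apply: (@continuous_comp _ _ _ -%R u); [exact: opp_continuous|exact: cu].
Qed.

(** Periodicity passes to the limit along with continuity, so closeness alone is assumed of [u]. *)
Lemma contR_lim u : (forall e, 0 < e -> exists2 v, contR v & forall t, `|u t - v t| <= e) ->
  contR u.
Proof.
move=> h; split=> [t|x].
  apply/eqP; rewrite -subr_eq0 -normr_eq0; apply/eqP/le_anti; rewrite normr_ge0 andbT.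
  apply/ler_addgt0Pl => e e0; rewrite addr0.
  have [v [pv _] hv] := h (e / 2) (divr_gt0 e0 (ltr0n _ 2)).
  have := hv (t + T); rewrite pv distrC; have := hv t => h1 h2.
  rewrite (_ : u (t + T) - u t = (u (t + T) - v t) - (u t - v t)); last by ring.
  by have := ler_normB (u (t + T) - v t) (u t - v t); rewrite (distrC _ (v t)); lra.
apply/cvgrPdist_le => e e0.
have [v [_ cv] hv] := h (e / 3) (divr_gt0 e0 (ltr0n _ 3)).
have := cv x => /cvgrPdist_le/(_ (e / 3) (divr_gt0 e0 (ltr0n _ 3))).
apply: filterS => y hy.
have := hv x; have := hv y; rewrite !ler_norml in hy *; lra.
Qed.

Lemma contR_per u (k : int) t : contR u -> u (t + k%:~R * T) = u t.
Proof.
move=> [pu _]; have pn (n : nat) s : u (s + n%:R * T) = u s.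
  elim: n => [|n IH]; first by rewrite mul0r addr0.
  by rewrite -natr1 mulrDl mul1r addrA pu.
case: k => n; first exact: pn.
by rewrite NegzE mulrNz mulNr -(pn n.+1 (t - _)) subrK.
Qed.

Lemma reduce_mod (x : R) : exists k : int, 0 <= x + k%:~R * T <= T.
Proof.
have T0 := T_gt0; exists (- Num.floor (x / T)).
have := floor_itv (x / T); rewrite intrD mulrNz => /andP[h1 h2].
have -> : x + - (Num.floor (x / T))%:~R * T = (x / T - (Num.floor (x / T))%:~R) * T.
  by rewrite mulrBl divfK ?gt_eqF// mulNr.
rewrite mulr_ge0 ?subr_ge0 ?(ltW T0)//= -[leRHS]mul1r ler_pM2r// lerBlDl ltW//.
Qed.

Lemma contR_bounded u : contR u -> exists M : R, forall t, `|u t| <= M.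
Proof.
move=> hu; have [pu cu] := hu.
have ab : 0 <= T := ltW T_gt0.
have cw : {within `[0, T], continuous (fun t => `|u t|)}.
  by apply: continuous_subspaceT => t; apply: cvg_norm; exact: cu.
have [c _ hc] := EVT_max ab cw.
exists `|u c| => t; have [k kT] := reduce_mod t.
by rewrite -(contR_per k t hu); apply: hc; rewrite in_itv.
Qed.

Lemma contT_bounded f : contT f -> exists M : R, forall t, cabs (f t) <= M.
Proof.
move=> hf; have [M hM] := contR_bounded (contT_Re hf).
have [M' hM'] := contR_bounded (contT_Im hf).
exists (M + M') => t; apply: le_trans (cabs_le _) _; exact: lerD.
Qed.

(** Uniform continuity in Korovkin form: 1 - cos(t - s) vanishes only when s = t modulo the period
    and is bounded below away from there, so a large multiple of it absorbs the oscillation of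
    [u]. *)
Lemma contR_modulus u (e : R) : contR u -> 0 < e ->
  exists2 K : R, 0 <= K & forall s t, `|u s - u t| <= e + K * (1 - cos (t - s)).
Proof.
move=> hu e0; have [pu cu] := hu; have [M hM] := contR_bounded hu.
have T0 := T_gt0; have pi0 := pi_gt0 R.
have M0 : 0 <= M := le_trans (normr_ge0 _) (hM 0).
pose P (K t : R) := forall s, `|u s - u t| <= e + K * (1 - cos (t - s)).
suff [K [K0 hK]] : exists K, 0 <= K /\ forall t, t \in `[0, T] -> P K t.
  exists K => // s t; have [k kT] := reduce_mod t.
  rewrite -(contR_per k t hu) -(contR_per k s hu).
  by rewrite (_ : t - s = (t + k%:~R * T) - (s + k%:~R * T)); [apply: hK; rewrite in_itv|ring].
(* Compactness is applied with the filter at infinity on [K]: each point of [0, T] gives a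
   neighbourhood together with a threshold for [K], and finitely many suffice. *)
have := @segment_compact R 0 T => /compact_near_coveringP.
move=> /(_ R +oo P _) [|B [_ hB]]; last first.
  pose K := Num.max 0 (B + 1); exists K; split; first by rewrite le_max lexx.
  by move=> t tT; apply: hB => //=; rewrite lt_max ltrDl ltr01 orbT.
move=> x _.
have := cu x => /cvgrPdist_le/(_ (e / 2) (divr_gt0 e0 (ltr0n _ 2))).
move=> /nbhs_ballP[d0 /= d00 hd0].
(* Capping [d] by pi keeps d / 2 in [0, pi], where cos is strictly decreasing. *)
pose d := Num.min d0 pi; have d0' : 0 < d by rewrite lt_min d00.
have hd y : `|x - y| < d -> `|u x - u y| <= e / 2.
  by move=> xy; apply: hd0 => /=; apply: lt_le_trans xy _; rewrite ge_min lexx.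
have dpi : d <= pi by rewrite ge_min lexx orbT.
clearbody d.
have id2 : d / 2 \in `[0, pi] by rewrite in_itv/=; apply/andP; split; lra.
have c1 : cos (d / 2) < 1.
  have i0 : (0 : R) \in `[0, pi] by rewrite in_itv/= lexx ltW.
  by rewrite -[ltRHS](cos0 R) (ltr_cos i0 id2) divr_gt0.
near=> y K => s.
(* [s] is replaced by its translate within pi of [y], which changes neither [u] nor the cosine. *)
have [k0 hk] := reduce_mod (s - y + pi); pose s' := s + k0%:~R * T.
have -> : cos (y - s) = cos (y - s').
  have hc : contR cos by split; [exact: cosD2pi|exact: continuous_cos].
  rewrite /s' (_ : y - (s + _) = (y - s) + (- k0)%:~R * T) ?(contR_per (- k0) (y - s) hc)//.
  by rewrite mulrNz; ring.
rewrite -(contR_per k0 s hu) -/s'.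
have ys' : - pi <= s' - y <= pi by move: hk; rewrite /s'; lra.
have xy : `|x - y| < d / 2 by near: y; apply: nbhsx_ballx; rewrite divr_gt0.
(* If [s'] is near [y], both lie within [d] of [x] and continuity gives e / 2 twice. If not, 1 -
   cos(y - s') is at least 1 - cos(d / 2), and the size of [K] makes the product exceed 2M. *)
have [near|far] := ltP `|y - s'| (d / 2).
  have h1 := hd y (lt_trans xy _); have h2 := hd s' _.
  have : 0 <= K by near: K; exact: nbhs_pinfty_ge.
  have : 0 <= 1 - cos (y - s') by rewrite subr_ge0 cos_le1.
  have : `|u x - u y| <= e / 2 by apply: h1; lra.
  have : `|u x - u s'| <= e / 2.
    apply: h2; rewrite (_ : x - s' = (x - y) + (y - s')); last by ring.
    by apply: le_lt_trans (ler_normD _ _) _; lra.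
  rewrite !ler_norml => ? ? ? ?.
  have /= : 0 <= K * (1 - cos (y - s')) by apply: mulr_ge0.
  lra.
have hK : 2 * M / (1 - cos (d / 2)) <= K.
  by near: K; apply: nbhs_pinfty_ge; rewrite num_real.
have hcos : cos (y - s') <= cos (d / 2).
  have iy : `|y - s'| \in `[0, pi] by rewrite in_itv/= normr_ge0 distrC ler_norml.
  by rewrite -(cos_norm (y - s')) leNgt (ltr_cos iy id2) -leNgt.
have : 2 * M <= K * (1 - cos (d / 2)) by rewrite -ler_pdivrMr// subr_gt0.
have : 0 <= K by apply: le_trans hK; rewrite divr_ge0 ?mulr_ge0// subr_ge0 ltW.
have := hM s'; have := hM y; rewrite !ler_norml => ? ? K0 ?.
have : K * (1 - cos (d / 2)) <= K * (1 - cos (y - s')) by rewrite ler_wpM2l// lerB.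
move=> hKK /=; lra.
Unshelve. all: by end_near.
Qed.

End ContinuousPeriodic.

(** * Complex-valued integrals over a measure space *)

Section ComplexIntegral.
Context d (X : measurableType d) (R : realType) (mu : {measure set X -> \bar R}).
Variables (D : set X) (mD : measurable D).
Local Notation C := R[i].
Implicit Types (u v : X -> R) (f g : X -> C).

Definition intR u := mu.-integrable D (EFin \o u).
Definition intC f := intR (fun t => cRe (f t)) /\ intR (fun t => cIm (f t)).
Definition Ic f : C :=
  Complex (\int[mu]_(t in D) cRe (f t)) (\int[mu]_(t in D) cIm (f t)).

Lemma intRD u v : intR u -> intR v -> intR (fun t => u t + v t).
Proof. by move=> hu hv; exact: (integrableD mD hu hv). Qed.

Lemma intRZ (k : R) u : intR u -> intR (fun t => k * u t).
Proof. by move=> hu; exact: (integrableZl mD k hu). Qed.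

Lemma intRN u : intR u -> intR (fun t => - u t).
Proof. by move=> /(intRZ (-1)); rewrite /intR; under eq_fun do rewrite mulN1r. Qed.

Lemma intRB u v : intR u -> intR v -> intR (fun t => u t - v t).
Proof. by move=> hu /intRN hv; exact: intRD. Qed.

Lemma intR_norm u : intR u -> intR (fun t => `|u t|).
Proof. by move=> hu; exact: (integrable_norm hu). Qed.

Lemma intR_bounded_mul (w : X -> R) (M : R) u : measurable_fun D w ->
  (forall t, `|w t| <= M) -> intR u -> intR (fun t => w t * u t).
Proof.
move=> mw wM hu; apply: (integrableMr mD mw _ hu).
by exists M; split; rewrite ?num_real// => x Mx t _ /=; exact: le_trans (wM t) (ltW Mx).
Qed.

Lemma intC_linear (a : C) f g : intC f -> intC g -> intC (fun t => a * f t + g t).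
Proof.
move=> [f1 f2] [g1 g2]; split.
  have := intRD (intRB (intRZ (cRe a) f1) (intRZ (cIm a) f2)) g1.
  by rewrite /intR; congr (mu.-integrable _ _); apply/funext => t /=; rewrite !cRI.
have := intRD (intRD (intRZ (cRe a) f2) (intRZ (cIm a) f1)) g2.
by rewrite /intR; congr (mu.-integrable _ _); apply/funext => t /=; rewrite !cRI.
Qed.

Lemma Ic_linear (a : C) f g : intC f -> intC g ->
  Ic (fun t => a * f t + g t) = a * Ic f + Ic g.
Proof.
move=> [f1 f2] [g1 g2]; apply: eqC; rewrite !cRI /Ic {1}/cRe {1}/cIm /=.
- under eq_Rintegral do rewrite cReD cReM.
  rewrite RintegralD ?RintegralB ?RintegralZl//; last first.
  - exact: intRB (intRZ _ f1) (intRZ _ f2).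
  - exact: (intRZ (cIm a) f2).
  - exact: (intRZ (cRe a) f1).
- under eq_Rintegral do rewrite cImD cImM.
  rewrite RintegralD ?RintegralD ?RintegralZl//; last first.
  - exact: intRD (intRZ _ f2) (intRZ _ f1).
  - exact: (intRZ (cIm a) f1).
  - exact: (intRZ (cRe a) f2).
Qed.

(** The factor 2 comes from bounding real and imaginary parts separately; the sharp constant 1 would
    need a rotation of the integral. *)
Lemma Ic_le f (w : X -> R) : intC f -> intR w -> (forall t, D t -> cabs (f t) <= w t) ->
  cabs (Ic f) <= 2 * \int[mu]_(t in D) w t.
Proof.
move=> [f1 f2] hw fw; apply: le_trans (cabs_le _) _.
rewrite mulrDl mul1r {1}/cRe {1}/cIm /=; apply: lerD.
  apply: le_trans (le_normr_Rintegral mD f1) _; apply: le_Rintegral => //.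
    exact: intR_norm.
  by move=> t Dt; apply: le_trans (cRe_le _) (fw t Dt).
apply: le_trans (le_normr_Rintegral mD f2) _; apply: le_Rintegral => //.
  exact: intR_norm.
by move=> t Dt; apply: le_trans (cIm_le _) (fw t Dt).
Qed.

Lemma intC_bounded_mul (w f : X -> C) (M : R) :
  measurable_fun D (fun t => cRe (w t)) -> measurable_fun D (fun t => cIm (w t)) ->
  (forall t, cabs (w t) <= M) -> intC f -> intC (fun t => w t * f t).
Proof.
move=> w1 w2 wM [f1 f2].
have hr t : `|cRe (w t)| <= M := le_trans (cRe_le _) (wM t).
have hi t : `|cIm (w t)| <= M := le_trans (cIm_le _) (wM t).
split.
  have := intRB (intR_bounded_mul w1 hr f1) (intR_bounded_mul w2 hi f2).
  by rewrite /intR; congr (mu.-integrable _ _); apply/funext => t /=; rewrite !cRI.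
have := intRD (intR_bounded_mul w1 hr f2) (intR_bounded_mul w2 hi f1).
by rewrite /intR; congr (mu.-integrable _ _); apply/funext => t /=; rewrite !cRI.
Qed.

End ComplexIntegral.

Section CircleIntegral.
Variable R : realType.
Local Notation C := R[i].
Local Notation T := (pi *+ 2 : R).
Local Notation leb := (@lebesgue_measure R).
Local Notation D := (`[0%R, (pi *+ 2 : R)]%classic).
Implicit Types (u v : R -> R) (f g h : R -> C).

Lemma measurable_circle : @measurable _ (measurableTypeR R) D.
Proof. exact: measurable_itv. Qed.

Lemma contR_measurable u (E : set (measurableTypeR R)) : measurable E -> contR u ->
  measurable_fun E (u : measurableTypeR R -> R).
Proof.
move=> mE [_ cu]; apply: subspace_continuous_measurable_fun => //.
exact: continuous_subspaceT.
Qed.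

Lemma contR_int u : contR u -> intR leb D u.
Proof.
move=> [_ cu]; apply: continuous_compact_integrable; first exact: segment_compact.
exact: continuous_subspaceT.
Qed.

Lemma contT_L1 f : contT f -> L1T f.
Proof. by move=> /contTE[f1 f2]; split; exact: contR_int. Qed.

Lemma cintE h : cint h = (T^-1)%:C%C * Ic leb D h.
Proof. by apply: eqC; rewrite ?cRe_parts ?cIm_parts !cRI /cRe /cIm /=; ring. Qed.

Lemma cint_linear (a : C) f g : L1T f -> L1T g ->
  cint (fun t => a * f t + g t) = a * cint f + cint g.
Proof. by move=> hf hg; rewrite !cintE (Ic_linear measurable_circle a hf hg); ring. Qed.

Lemma cint_le f (w : R -> R) : L1T f -> intR leb D w -> (forall t, D t -> cabs (f t) <= w t) ->
  cabs (cint f) <= 2 * (T^-1 * \int[leb]_(t in D) w t).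
Proof.
move=> hf hw fw; rewrite cintE cabsM cabs_real ger0_norm ?invr_ge0 ?(ltW (T_gt0 R))//.
by rewrite mulrCA ler_wpM2l ?invr_ge0 ?(ltW (T_gt0 R))// Ic_le//; exact: measurable_circle.
Qed.

Lemma mean_cst (x : R) : T^-1 * \int[leb]_(t in D) x = x.
Proof.
have T0 := T_gt0 R.
rewrite Rintegral_cst; last exact: measurable_circle.
rewrite /= lebesgue_measure_itv /= lte_fin T0 sube0 /=.
by rewrite mulrC mulfK// gt_eqF.
Qed.

Lemma cint_le_cst f (s : R) : L1T f -> (forall t, cabs (f t) <= s) ->
  cabs (cint f) <= 2 * s.
Proof.
move=> hf fs; rewrite -[X in 2 * X]mean_cst; apply: cint_le => //.
exact: contR_int (contR_cst s).
Qed.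

Lemma cint_sum (I : Type) (r : seq I) (a : I -> C) (F : I -> R -> C) :
  (forall i, L1T (F i)) ->
  L1T (fun t => \sum_(i <- r) a i * F i t) /\
  cint (fun t => \sum_(i <- r) a i * F i t) = \sum_(i <- r) a i * cint (F i).
Proof.
move=> hF; elim: r => [|i r [IH1 IH2]].
  have -> : (fun t => \sum_(i <- [::]) a i * F i t) = (fun=> 0).
    by apply/funext => t; rewrite big_nil.
  have h0 : L1T (fun=> 0 : C).
    by split; exact: (contR_int (contR_cst 0)).
  split => //; rewrite big_nil; apply: cabs_sub_le => e e0; rewrite subr0.
  apply: le_trans (cint_le_cst (s := 0) h0 _) _; first by move=> t; rewrite cabs0.
  by rewrite mulr0 ltW.
have -> : (fun t => \sum_(j <- i :: r) a j * F j t) =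
          (fun t => a i * F i t + \sum_(j <- r) a j * F j t).
  by apply/funext => t; rewrite big_cons.
split; first exact: (intC_linear measurable_circle (a i) (hF i) IH1).
by rewrite cint_linear// IH2 big_cons.
Qed.

Definition ek (k : int) : R -> C := fun t => expi (k%:~R * t).

Lemma cabs_ek k t : cabs (ek k t) = 1.
Proof. exact: cabs_expi. Qed.

Lemma ekD j k t : ek (j + k) t = ek j t * ek k t.
Proof. by rewrite /ek -expiD intrD mulrDl. Qed.

Lemma ek0 t : ek 0 t = 1.
Proof. by rewrite /ek mul0r expi0. Qed.

Lemma ekN k t : ek k (- t) = ek (- k) t.
Proof. by rewrite /ek mulrN mulrNz mulNr. Qed.

Lemma ek_shift k s t : ek k (s + t) = ek k s * ek k t.
Proof. by rewrite /ek mulrDr expiD. Qed.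

Lemma contR_cos : contR (@cos R).
Proof. by split; [exact: cosD2pi|exact: continuous_cos]. Qed.

Lemma contR_sin : contR (@sin R).
Proof. by split; [exact: sinD2pi|exact: continuous_sin]. Qed.

Lemma contR_scale u (k : int) : contR u -> contR (fun t => u (k%:~R * t)).
Proof.
move=> hu; split => t; first by rewrite mulrDr contR_per.
apply: (@continuous_comp _ _ _ (fun t : R => k%:~R * t) u); last exact: hu.2.
by apply: cvgM; [exact: cvg_cst|exact: cvg_id].
Qed.

Lemma contT_ek k : contT (ek k).
Proof.
apply/contTE; split; [exact: (contR_scale k contR_cos)|exact: (contR_scale k contR_sin)].
Qed.

Lemma contT_linear (a : C) f g : contT f -> contT g -> contT (fun t => a * f t + g t).
Proof.
move=> /contTE[f1 f2] /contTE[g1 g2]; apply/contTE; split.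
  have := contRD (contRB (contRM (contR_cst (cRe a)) f1) (contRM (contR_cst (cIm a)) f2)) g1.
  by congr contR; apply/funext => t; rewrite !cRI.
have := contRD (contRD (contRM (contR_cst (cRe a)) f2) (contRM (contR_cst (cIm a)) f1)) g2.
by congr contR; apply/funext => t; rewrite !cRI.
Qed.

Lemma contTM f g : contT f -> contT g -> contT (fun t => f t * g t).
Proof.
move=> /contTE[f1 f2] /contTE[g1 g2]; apply/contTE; split.
  have := contRB (contRM f1 g1) (contRM f2 g2).
  by congr contR; apply/funext => t; rewrite !cRI.
have := contRD (contRM f1 g2) (contRM f2 g1).
by congr contR; apply/funext => t; rewrite !cRI.
Qed.

Lemma contT_cst (a : C) : contT (fun=> a).
Proof. by apply/contTE; split; exact: contR_cst. Qed.

Lemma contTB f g : contT f -> contT g -> contT (fun t => f t - g t).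
Proof.
move=> hf hg; have := contT_linear (-1) hg hf.
by congr contT; apply/funext => t; rewrite mulN1r addrC.
Qed.

Lemma contT_opp f : contT f -> contT (fun t => f (- t)).
Proof. by move=> /contTE[f1 f2]; apply/contTE; split; [exact: contR_opp f1|exact: contR_opp f2]. Qed.

Lemma contT_shift f a : contT f -> contT (fun t => f (t + a)).
Proof. by move=> /contTE[f1 f2]; apply/contTE; split; [exact: contR_shift f1|exact: contR_shift f2]. Qed.

Lemma contT_sum (I : Type) (r : seq I) (a : I -> C) (F : I -> R -> C) :
  (forall i, contT (F i)) -> contT (fun t => \sum_(i <- r) a i * F i t).
Proof.
move=> hF; elim: r => [|i r IH].
  by under eq_fun do rewrite big_nil; exact: contT_cst.
by under eq_fun do rewrite big_cons; exact: contT_linear.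
Qed.

Lemma contT_lim f : (forall e : R, 0 < e -> exists2 g, contT g & forall t, cabs (f t - g t) <= e) ->
  contT f.
Proof.
move=> h; apply/contTE; split; apply: contR_lim => e /h[g /contTE[g1 g2] fg];
  [exists (fun t => cRe (g t))|exists (fun t => cIm (g t))] => // t;
  by apply: le_trans (fg t); rewrite -?cReN -?cReD -?cImN -?cImD ?cRe_le ?cIm_le.
Qed.

Lemma L1T_bounded_mul f g : contT f -> L1T g -> L1T (fun t => f t * g t).
Proof.
move=> hf hg; have [M hM] := contT_bounded hf; move/contTE: hf => [f1 f2].
by apply: (intC_bounded_mul measurable_circle _ _ hM hg); apply: contR_measurable => //; exact: measurable_circle.
Qed.

Lemma int_cos_scale (k : int) : k != 0 -> \int[leb]_(t in D) cos (k%:~R * t) = 0.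
Proof.
move=> k0; pose F t := (k%:~R : R)^-1 * sin (k%:~R * t).
have kR : (k%:~R : R) != 0 by rewrite intr_eq0.
have dF (t : R) : is_derive t 1 F (cos (k%:~R * t)).
  rewrite /F; apply: is_derive_eq.
  by rewrite /GRing.scale /=; field.
rewrite /Rintegral (@continuous_FTC2 _ _ F)//.
- have := contR_per (u := sin) k 0 contR_sin; rewrite add0r => h.
  by rewrite /F h mulr0 /= subrr.
- exact: T_gt0.
- by apply: continuous_subspaceT; exact: (contR_scale k contR_cos).2.
- have dc t : F @ t --> F t.
    by apply: differentiable_continuous; apply/derivable1_diffP; have [] := dF t.
  split=> //.
  + exact: cvg_at_right_filter.
  + exact: cvg_at_left_filter.
- by move=> t _; rewrite derive1E; apply: derive_val.
Qed.

Lemma int_sin_scale (k : int) : \int[leb]_(t in D) sin (k%:~R * t) = 0.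
Proof.
have [->|k0] := eqVneq k 0.
  by under eq_Rintegral do rewrite mul0r sin0; rewrite Rintegral_cst ?measurable_circle// mul0r.
pose F t := - ((k%:~R : R)^-1 * cos (k%:~R * t)).
have kR : (k%:~R : R) != 0 by rewrite intr_eq0.
have dF (t : R) : is_derive t 1 F (sin (k%:~R * t)).
  rewrite /F; apply: is_derive_eq.
  by rewrite /GRing.scale /=; field.
rewrite /Rintegral (@continuous_FTC2 _ _ F)//.
- have := contR_per (u := cos) k 0 contR_cos; rewrite add0r => h.
  by rewrite /F h mulr0 /= subrr.
- exact: T_gt0.
- by apply: continuous_subspaceT; exact: (contR_scale k contR_sin).2.
- have dc t : F @ t --> F t.
    by apply: differentiable_continuous; apply/derivable1_diffP; have [] := dF t.
  split=> //.
  + exact: cvg_at_right_filter.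
  + exact: cvg_at_left_filter.
- by move=> t _; rewrite derive1E; apply: derive_val.
Qed.

Lemma cint_ek k : cint (ek k) = (k == 0)%:R.
Proof.
apply: eqC; rewrite ?cRe_parts ?cIm_parts.
  have [->|k0] := eqVneq k 0; last by rewrite int_cos_scale// mulr0.
  by under eq_Rintegral do rewrite ek0; rewrite mean_cst.
by rewrite int_sin_scale mulr0; case: (k == 0).
Qed.

End CircleIntegral.

(** * Density of trigonometric polynomials *)

Section Functionals.
Variable R : realType.
Local Notation C := R[i].
Implicit Types (f g : R -> C) (L : (R -> C) -> C).

Lemma blf_linear L (a : C) f g : bdd_lin_functional L -> contT f -> contT g ->
  L (fun t => a * f t + g t) = a * L f + L g.
Proof. by move=> [h _]; exact: h. Qed.

Lemma blf_bound L : bdd_lin_functional L -> exists2 M : R, 0 <= M &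
  forall f s, contT f -> (forall t, cabs (f t) <= s) -> cabs (L f) <= M * s.
Proof.
move=> [_ [M hM]]; exists `|M| => // f s hf fs; apply: le_trans (hM f s hf fs) _.
by rewrite ler_wpM2r ?ler_norm// (le_trans (cabs_ge0 (f 0))).
Qed.

Lemma blfB L f g : bdd_lin_functional L -> contT f -> contT g ->
  L (fun t => f t - g t) = L f - L g.
Proof.
move=> hL hf hg; rewrite -mulN1r addrC -blf_linear//; congr L.
by apply/funext => t; rewrite mulN1r addrC.
Qed.

(** The linearity clause speaks only of combinations c f + g, so a f is written as (a f + f) - f. *)
Lemma blfZ L (a : C) f : bdd_lin_functional L -> contT f ->
  L (fun t => a * f t) = a * L f.
Proof.
move=> hL hf; rewrite -[RHS](addrK (L f)) -blf_linear// -blfB//; last exact: contT_linear.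
by congr L; apply/funext => t; rewrite addrK.
Qed.

Lemma blf_sum L (I : Type) (r : seq I) (a : I -> C) (F : I -> R -> C) :
  bdd_lin_functional L -> (forall i, contT (F i)) ->
  L (fun t => \sum_(i <- r) a i * F i t) = \sum_(i <- r) a i * L (F i).
Proof.
move=> hL hF; elim: r => [|i r IH].
  rewrite big_nil; under eq_fun do rewrite big_nil.
  have h := blfB hL (contT_cst 0) (contT_cst 0).
  rewrite -[RHS](subrr (L (fun=> 0))) -h.
  by congr L; apply/funext => t; rewrite subrr.
rewrite big_cons -IH -blf_linear//; last exact: contT_sum.
by congr L; apply/funext => t; rewrite big_cons.
Qed.

End Functionals.

Section Fejer.
Variable R : realType.
Local Notation C := R[i].
Local Notation T := (pi *+ 2 : R).
Local Notation leb := (@lebesgue_measure R).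
Local Notation D := (`[0%R, (pi *+ 2 : R)]%classic).
Local Notation ek := (@ek R).
Implicit Types (f g : R -> C) (n : nat).

(** The Fejer kernel as the squared modulus of a geometric sum of characters, which makes positivity
    immediate. *)
Definition fejer n (u : R) : R :=
  n.+1%:R^-1 * cabs (\sum_(j < n.+1) ek j%:Z u) ^+ 2.

Local Notation diff n p := ((p : 'I_n.+1 * 'I_n.+1).1%:Z - p.2%:Z).

(** Summing over pairs (i, j) replaces the usual weight (n + 1 - |k|) / (n + 1), which counts the
    pairs with difference k. *)
Definition fejer_sum n f (t : R) : C :=
  \sum_(p : 'I_n.+1 * 'I_n.+1) (n.+1%:R^-1 * fhat f (diff n p)) * ek (diff n p) t.

Lemma fhatE f k : fhat f k = cint (fun s => f s * ek (- k) s).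
Proof. by congr cint; apply/funext => s; rewrite /ek mulrNz mulNr. Qed.

Lemma fejer_ge0 n u : 0 <= fejer n u.
Proof. by rewrite mulr_ge0 ?invr_ge0 ?ler0n ?exprn_ge0 ?cabs_ge0. Qed.

Lemma fejerE n u : (fejer n u)%:C%C =
  \sum_(p : 'I_n.+1 * 'I_n.+1) n.+1%:R^-1 * ek (diff n p) u.
Proof.
have sq (z : C) : (cabs z ^+ 2)%:C%C = z * (z^*)%C.
  case: z => x y; rewrite /cabs /= sqr_sqrtr ?addr_ge0 ?sqr_ge0//.
  by apply: eqC; rewrite ?cRI /cRe /cIm /=; ring.
have cj k : ((ek k u)^*)%C = ek (- k) u.
  by rewrite /ek mulrNz mulNr /expi cosN sinN.
rewrite /fejer rmorphM /= sq rmorph_sum mulr_suml -mulr_sumr; congr (_ * _).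
  by rewrite fmorphV /= rmorph_nat.
rewrite -(pair_bigA _ (fun i j : 'I_n.+1 => ek (i%:Z - j%:Z) u)) /=.
apply: eq_bigr => i _; rewrite mulr_sumr; apply: eq_bigr => j _.
by rewrite ekD -cj.
Qed.

(** With z = e^{iu} one has |z - 1|^2 = 2 (1 - cos u), and the geometric sum S satisfies |z - 1| |S|
    = |z^{n+1} - 1|, which is at most 2. *)
Lemma fejer_cos n u : (1 - cos u) * fejer n u <= 2 / n.+1%:R.
Proof.
set z := ek 1 u.
have zj (j : nat) : ek j%:Z u = z ^+ j.
  elim: j => [|j IH]; first exact: ek0.
  by rewrite exprS -IH -ekD -PoszD add1n.
rewrite /fejer (eq_bigr (fun j : 'I_n.+1 => z ^+ j)) => [|j _]; last exact: zj.
set S := \sum_(_ < _) _.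
have h1 : cabs (z - 1) ^+ 2 = 2 * (1 - cos u).
  rewrite /z /ek mul1r /cabs /= sqr_sqrtr ?addr_ge0 ?sqr_ge0//.
  by have := cos2Dsin2 u; nra.
have h2 : cabs (z - 1) * cabs S <= 2.
  rewrite -cabsM /S -subrX1 (le_trans (cabsD _ _))// cabsN cabs1 -zj cabs_ek.
  by rewrite (_ : 1 + 1 = 2).
rewrite mulrCA mulrC ler_pM2r ?invr_gt0 ?ltr0Sn//.
have := mulr_ge0 (cabs_ge0 (z - 1)) (cabs_ge0 S).
have : (1 - cos u) * cabs S ^+ 2 *+ 2 = (cabs (z - 1) * cabs S) ^+ 2.
  by rewrite exprMn h1; ring.
by rewrite expr2; nra.
Qed.

Lemma contT_fejer n t : contT (fun s => (fejer n (t - s))%:C)%C.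
Proof.
have -> : (fun s => (fejer n (t - s))%:C)%C = (fun s =>
    \sum_(p : 'I_n.+1 * 'I_n.+1) (n.+1%:R^-1 * ek (diff n p) t) * ek (- diff n p) s).
  apply/funext => s; rewrite fejerE; apply: eq_bigr => p _.
  by rewrite ek_shift ekN mulrA.
by apply: contT_sum => p; exact: contT_ek.
Qed.

Lemma fejer_sumE n f t : contT f ->
  fejer_sum n f t = cint (fun s => f s * (fejer n (t - s))%:C%C).
Proof.
move=> hf; rewrite /fejer_sum.
pose F p s := f s * ek (- diff n p) s.
have hF p : L1T (F p) by apply/contT_L1/contTM => //; exact: contT_ek.
have := (cint_sum (index_enum _) (fun p => n.+1%:R^-1 * ek (diff n p) t) hF).2.
rewrite (_ : (fun s => \sum_p _) = (fun s => f s * (fejer n (t - s))%:C%C)).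
  by move=> ->; apply: eq_bigr => p _; rewrite fhatE mulrAC.
apply/funext => s; rewrite fejerE mulr_sumr; apply: eq_bigr => p _.
by rewrite ek_shift ekN /F; ring.
Qed.

(** This is the Fejer sum of the constant 1, in which only the n + 1 diagonal pairs survive, each
    with weight 1 / (n + 1). *)
Lemma fejer_mean n t : cint (fun s => (fejer n (t - s))%:C%C) = 1.
Proof.
have := fejer_sumE n t (contT_cst 1).
rewrite (_ : (fun s => 1 * _) = (fun s => (fejer n (t - s))%:C%C)); last first.
  by apply/funext => s; rewrite mul1r.
move=> <-; rewrite /fejer_sum.
transitivity (\sum_(i < n.+1) \sum_(j < n.+1 | j == i) (n.+1%:R^-1 : C)); last first.
  under eq_bigr do rewrite big_pred1_eq.
  by rewrite sumr_const card_ord -[LHS]mulr_natl mulfV// pnatr_eq0.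
rewrite pair_big_dep /= [RHS]big_mkcond /=; apply: eq_bigr => -[i j] _ /=.
rewrite fhatE (_ : (fun s => 1 * _) = ek (- (i%:Z - j%:Z))); last first.
  by apply/funext => s; rewrite mul1r.
rewrite cint_ek oppr_eq0 subr_eq0 eqz_nat eq_sym -val_eqE /=.
by case: eqVneq => [->|_]; rewrite ?subrr ?ek0 ?mulr1 ?mulr0 ?mul0r.
Qed.

Lemma contT_modulus f (e : R) : contT f -> 0 < e ->
  exists2 K : R, 0 <= K & forall s t, cabs (f s - f t) <= e + K * (1 - cos (t - s)).
Proof.
move=> /contTE[f1 f2] e0; have e20 : 0 < e / 2 by rewrite divr_gt0.
have [K K0 hK] := contR_modulus f1 e20; have [L L0 hL] := contR_modulus f2 e20.
exists (K + L); first exact: addr_ge0.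
move=> s t; apply: le_trans (cabs_le _) _; rewrite !cRI.
by have := hK s t; have := hL s t; lra.
Qed.

(* Korovkin's argument: fejer is a positive kernel of mean 1 against which
   1 - cos has small mass, and 1 - cos controls the oscillation of f. *)
Lemma fejer_approx f (e : R) : contT f -> 0 < e ->
  exists n, forall t, cabs (f t - fejer_sum n f t) <= e.
Proof.
move=> hf e0; have e40 : 0 < e / 4 by rewrite divr_gt0.
have [K K0 hK] := contT_modulus hf e40.
(* This makes 2K / (n + 1) at most e / 4. The kernel integral is then at most e / 4 + e / 4, and
   [cint_le] doubles it. *)
have [n hn] : exists n : nat, 8 * K / e <= n.+1%:R.
  have := archimedean.Num.Theory.truncnS_gt (8 * K / e) => h.
  by exists (Num.trunc (8 * K / e)); exact: ltW.
exists n => t; rewrite cabsB.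
pose G s := (fejer n (t - s))%:C%C : C.
have hG : contT G := contT_fejer n t.
have -> : fejer_sum n f t - f t = cint (fun s => (f s - f t) * G s).
  transitivity (- f t * cint G + cint (fun s => f s * G s)).
    by rewrite fejer_mean fejer_sumE//; ring.
  rewrite -cint_linear.
  - by congr cint; apply/funext => s; rewrite mulNr mulrBl addrC.
  - exact: contT_L1.
  - exact/contT_L1/contTM.
have hw : contR (fun s => e / 4 * fejer n (t - s) + 2 * K / n.+1%:R).
  by apply: contRD (contR_cst _); apply: contRM (contR_cst _) (contT_Re hG).
apply: le_trans (cint_le _ (contR_int hw) _) _.
- apply/contT_L1/contTM => //; apply: contTB => //; exact: contT_cst.
- move=> s _; rewrite cabsM cabs_real ger0_norm ?fejer_ge0//.
  have := hK s t; have := fejer_cos n (t - s); have := fejer_ge0 n (t - s) => F0 F1 F2.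
  apply: le_trans (ler_wpM2r F0 F2) _; rewrite mulrDl lerD2l -mulrA -mulrA mulrCA.
  by have := ler_wpM2l K0 F1; rewrite mulrCA [K * (2 / _)]mulrCA.
rewrite RintegralD//; last 2 first.
- exact: (contR_int (contRM (contR_cst _) (contT_Re hG))).
- exact: (contR_int (contR_cst _)).
rewrite RintegralZl//; last exact: (contR_int (contT_Re hG)).
rewrite mulrDr mean_cst mulrCA.
have -> : T^-1 * \int[leb]_(s in D) fejer n (t - s) = 1.
  by have := congr1 (@cRe R) (fejer_mean n t); rewrite cRe_parts.
have : 2 * K / n.+1%:R <= e / 4.
  by rewrite ler_pdivrMr ?ltr0Sn//; move: hn; rewrite ler_pdivrMr//; nra.
set q := 2 * K / _ => hq; lra.
Qed.

(** Density of trigonometric polynomials packaged as an induction principle, so that later arguments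
    treat characters, linear combinations and uniform limits separately. *)
Lemma contT_ind (P : (R -> C) -> Prop) : (forall k, P (ek k)) ->
  (forall a f g, contT f -> contT g -> P f -> P g -> P (fun t => a * f t + g t)) ->
  (forall f, contT f -> (forall e : R, 0 < e ->
     exists g, [/\ contT g, P g & forall t, cabs (f t - g t) <= e]) -> P f) ->
  forall f, contT f -> P f.
Proof.
move=> Pek Plin Plim f hf; apply: Plim => // e e0.
have [n hn] := fejer_approx hf e0; exists (fejer_sum n f); split => //.
  by apply: contT_sum => p; exact: contT_ek.
rewrite /fejer_sum; elim: (index_enum _) => [|p r IH].
  (* [P] is closed only under combinations of functions already satisfying it, so the empty sum is
     written as e_0 - e_0. *)
  rewrite (_ : (fun t => _) = (fun t => (-1) * ek 0 t + ek 0 t)).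
    by apply: Plin => //; exact: contT_ek.
  by apply/funext => t; rewrite big_nil mulN1r addNr.
under eq_fun do rewrite big_cons; apply: Plin => //; first exact: contT_ek.
by apply: contT_sum => q; exact: contT_ek.
Qed.

(** This takes the place of changes of variables: an identity between two functionals is tested on
    characters only. *)
Lemma blf_ext (L1 L2 : (R -> C) -> C) : bdd_lin_functional L1 -> bdd_lin_functional L2 ->
  (forall k, L1 (ek k) = L2 (ek k)) -> forall f, contT f -> L1 f = L2 f.
Proof.
move=> h1 h2 h12; apply: contT_ind => // [a f g hf hg fE gE|f hf hfg].
  by rewrite !blf_linear// fE gE.
have [M1 M10 hM1] := blf_bound h1; have [M2 M20 hM2] := blf_bound h2.
apply: cabs_sub_le => e e0.
(* The summand 1 keeps the denominator positive when both bounds vanish; the same device recurs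
   below. *)
pose e' := e / (M1 + M2 + 1); have e'0 : 0 < e' by rewrite divr_gt0//; lra.
have e'E : e' * (M1 + M2 + 1) = e by rewrite mulfVK//; lra.
have [g [hg gE fg]] := hfg _ e'0.
rewrite (_ : L1 f - L2 f = L1 (fun t => f t - g t) - L2 (fun t => f t - g t)); last first.
  by rewrite !blfB// gE; ring.
have := cabsD (L1 (fun t => f t - g t)) (- L2 (fun t => f t - g t)); rewrite cabsN.
have := hM1 _ _ (contTB hf hg) fg; have := hM2 _ _ (contTB hf hg) fg.
by nra.
Qed.

End Fejer.

Arguments measurable_circle {R}.

(** * Duality for multiplier sums *)

Section Pairings.
Variable R : realType.
Local Notation C := R[i].
Local Notation T := (pi *+ 2 : R).
Local Notation leb := (@lebesgue_measure R).
Local Notation D := (`[0%R, (pi *+ 2 : R)]%classic).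
Local Notation ek := (@ek R).
Implicit Types (f g h : R -> C) (L : (R -> C) -> C).

Lemma blf_axpy (a : C) L1 L2 : bdd_lin_functional L1 -> bdd_lin_functional L2 ->
  bdd_lin_functional (fun f => a * L1 f + L2 f).
Proof.
move=> h1 h2; split=> [c f g hf hg|]; first by rewrite !blf_linear//; ring.
have [M1 M10 hM1] := blf_bound h1; have [M2 M20 hM2] := blf_bound h2.
exists (cabs a * M1 + M2) => f s hf fs; rewrite mulrDl.
apply: le_trans (cabsD _ _) _; rewrite cabsM -mulrA.
by rewrite lerD ?ler_wpM2l ?cabs_ge0 ?hM1 ?hM2.
Qed.

Lemma blf_opp L : bdd_lin_functional L -> bdd_lin_functional (fun f => L (fun t => f (- t))).
Proof.
move=> hL; split=> [c f g hf hg|]; first by rewrite (blf_linear c hL)//; exact: contT_opp.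
have [M _ hM] := blf_bound hL; exists M => f s hf fs; apply: hM => //; exact: contT_opp.
Qed.

Lemma blf_shift L a : bdd_lin_functional L ->
  bdd_lin_functional (fun f => L (fun t => f (t + a))).
Proof.
move=> hL; split=> [c f g hf hg|]; first by rewrite (blf_linear c hL)//; exact: contT_shift.
have [M _ hM] := blf_bound hL; exists M => f s hf fs; apply: hM => //; exact: contT_shift.
Qed.

Lemma blf_eval (t : R) : bdd_lin_functional (fun f : R -> C => f t).
Proof. by split=> //; exists 1 => f s _ fs; rewrite mul1r. Qed.

(** An unnormalized norm equivalent to the L^1 norm. Its integrand is integrable directly from the
    two clauses of [L1T], without discussing the measurability of the modulus. *)
Definition nrm1 g : R := \int[leb]_(t in D) (`|cRe (g t)| + `|cIm (g t)|).

Lemma intR_nrm1 g : L1T g -> intR leb D (fun t => `|cRe (g t)| + `|cIm (g t)|).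
Proof.
by move=> hg; have [g1 g2] : intC leb D g := hg; exact: (intRD measurable_circle (intR_norm g1) (intR_norm g2)).
Qed.

Lemma nrm1_real (x : R -> R) : nrm1 (fun t => (x t)%:C%C) = \int[leb]_(t in D) `|x t|.
Proof. by apply: eq_Rintegral => t _; rewrite normr0 addr0. Qed.

Lemma cint_mul_le f g (s : R) : L1T g -> contT f -> (forall t, cabs (f t) <= s) ->
  cabs (cint (fun t => f t * g t)) <= 2 * T^-1 * nrm1 g * s.
Proof.
move=> hg hf fs; have hw := intR_nrm1 hg.
apply: le_trans (cint_le (L1T_bounded_mul hf hg) (intRZ measurable_circle s hw) _) _.
  by move=> t _; rewrite cabsM ler_pM ?cabs_ge0 ?cabs_le.
by rewrite (RintegralZl s measurable_circle hw) [s * _]mulrC !mulrA.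
Qed.

Lemma pairL1_le f g (s : R) : L1T g -> contT f -> (forall t, cabs (f t) <= s) ->
  cabs (pairL1 f g) <= 2 * T^-1 * nrm1 g * s.
Proof. by move=> hg hf fs; apply: cint_mul_le => //; exact: contT_opp. Qed.

Lemma blf_cint g : L1T g -> bdd_lin_functional (fun h => cint (fun t => h t * g t)).
Proof.
move=> hg; split=> [c f h hf hh|].
  rewrite -cint_linear; try exact: L1T_bounded_mul.
  by congr cint; apply/funext => t; rewrite mulrDl mulrA.
by exists (2 * T^-1 * nrm1 g) => h s hh hs; exact: cint_mul_le.
Qed.

Lemma blf_pairL1l g : L1T g -> bdd_lin_functional (fun f => pairL1 f g).
Proof. by move=> /blf_cint/blf_opp. Qed.

Lemma blf_pairL1r f : contT f -> bdd_lin_functional (fun h => pairL1 f h).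
Proof.
move=> /contT_opp/contT_L1/blf_cint; congr bdd_lin_functional.
by apply/funext => h; congr cint; apply/funext => t; rewrite mulrC.
Qed.

Lemma pairL1_ekl g k : pairL1 (ek k) g = fhat g k.
Proof. by rewrite fhatE; congr cint; apply/funext => t; rewrite ekN mulrC. Qed.

Lemma blf_fhat k : bdd_lin_functional (fun f => fhat f k).
Proof.
have := blf_pairL1r (contT_ek R k); congr bdd_lin_functional.
by apply/funext => f; exact: pairL1_ekl.
Qed.

Lemma fhat_ek j k : fhat (ek j) k = (j == k)%:R.
Proof.
rewrite fhatE -(subr_eq0 j) -cint_ek; congr cint; apply/funext => t.
by rewrite ekD.
Qed.

(** Directly this is the substitution t to -t over a period; on characters it is the symmetry of the
    Kronecker delta. *)
Lemma pairL1_ekr f k : contT f -> pairL1 f (ek k) = fhat f k.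
Proof.
apply: (blf_ext (blf_pairL1l (contT_L1 (contT_ek R k))) (blf_fhat k)) => j.
by rewrite pairL1_ekl !fhat_ek eq_sym.
Qed.

Lemma fhat_shift f a k : contT f -> fhat (fun t => f (t + a)) k = ek k a * fhat f k.
Proof.
(* The last component is the zero functional, written as a difference of two evaluations so that
   [blf_axpy] applies. *)
have h2 := blf_axpy (ek k a) (blf_fhat k) (blf_axpy (-1) (blf_eval 0) (blf_eval 0)).
move=> hf; rewrite (blf_ext (blf_shift a (blf_fhat k)) h2 _ hf) => [|j].
  by rewrite mulN1r addNr addr0.
rewrite mulN1r addNr addr0 fhat_ek (_ : (fun t => _) = (fun t => ek j a * ek j t)).
  rewrite (blfZ _ (blf_fhat k)) ?fhat_ek; last exact: contT_ek.
  by case: eqVneq => [->|_]; rewrite ?mulr0.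
by apply/funext => t; rewrite ek_shift mulrC.
Qed.

Lemma contR_int_finite (m : {finite_measure set (measurableTypeR R) -> \bar R}) (u : R -> R) :
  contR u -> intR m setT u.
Proof.
move=> hu; have [M hM] := contR_bounded hu.
apply: measurable_bounded_integrable => //.
- by rewrite ltey_eq fin_num_measure.
- exact: contR_measurable.
- by exists M; split; rewrite ?num_real// => x Mx t _ /=; exact: le_trans (hM t) (ltW Mx).
Qed.

Lemma blf_cintm (m : {finite_measure set (measurableTypeR R) -> \bar R}) :
  bdd_lin_functional (cintm m).
Proof.
have mE h : cintm m h = Ic m setT h.
  by apply: eqC; rewrite ?cRe_parts ?cIm_parts.
have iC f : contT f -> intC m setT f.
  by move=> /contTE[f1 f2]; split; exact: contR_int_finite.
split=> [a f g /iC hf /iC hg|]; first by rewrite !mE Ic_linear.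
exists (2 * fine (m setT)) => f s hf fs; rewrite mE.
apply: le_trans (Ic_le _ (iC _ hf) (contR_int_finite m (contR_cst s)) _) _ => //.
by rewrite Rintegral_cst// mulrAC mulrA.
Qed.

Lemma blf_pairM (mu : cmeasure R) : bdd_lin_functional (fun f => pairM f mu).
Proof.
apply: (@blf_opp (cintmu mu)).
have h12 := blf_axpy (-1) (blf_cintm (cm2 mu)) (blf_cintm (cm1 mu)).
have h34 := blf_axpy (-1) (blf_cintm (cm4 mu)) (blf_cintm (cm3 mu)).
have := blf_axpy 'i%C h34 h12; congr bdd_lin_functional.
by apply/funext => f; rewrite /cintmu !mulN1r addrC ![- _ + _]addrC.
Qed.

Lemma pairM_ek (mu : cmeasure R) k : pairM (ek k) mu = muhat mu k.
Proof. by congr cintmu; apply/funext => t; rewrite /ek mulrN. Qed.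

Lemma blf_ek_bounded L : bdd_lin_functional L -> exists X : R, forall k, cabs (L (ek k)) <= X.
Proof.
move=> /blf_bound[M _ hM]; exists (M * 1) => k.
by apply: hM => [|t]; [exact: contT_ek|rewrite cabs_ek].
Qed.

End Pairings.

(** * Multiplier sums and their adjoint relations *)

Section Multiplier.
Variables (R : realType) (a : nat -> int -> R[i]) (ha : forall n, abssum (a n)).
Local Notation C := R[i].
Local Notation ek := (@ek R).
Implicit Types (f g : R -> C) (L : (R -> C) -> C).

Lemma abssum_mul n (x : int -> C) : (exists X : R, forall k, cabs (x k) <= X) ->
  abssum (fun k => a n k * x k).
Proof. by move=> [X xX]; exact: abssumM xX (ha n). Qed.

Lemma Ssum_approx n (x : int -> C) : (exists X : R, forall k, cabs (x k) <= X) ->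
  forall e : R, 0 < e -> exists N, forall m, (N <= m)%N ->
  forall t, cabs (Ssum a n x t - symsum (fun k => a n k * x k * ek k t) m) <= e.
Proof.
move=> hx e e0; have [N hN] := zsum_tail (abssum_mul n hx) e0.
exists N => m Nm t; apply: (hN (fun k => a n k * x k * ek k t)) => // k.
by rewrite cabsM cabs_ek mulr1.
Qed.

Lemma contT_symsum (c : int -> C) m : contT (fun t => symsum (fun k => c k * ek k t) m).
Proof. by apply: contT_sum => i; exact: contT_ek. Qed.

Lemma contT_Ssum n (x : int -> C) : (exists X : R, forall k, cabs (x k) <= X) ->
  contT (Ssum a n x).
Proof.
move=> hx; apply: contT_lim => e e0; have [N hN] := Ssum_approx n hx e0.
exists (fun t => symsum (fun k => a n k * x k * ek k t) N); first exact: contT_symsum.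
exact: hN.
Qed.

Lemma blf_Ssum n (x : int -> C) L : (exists X : R, forall k, cabs (x k) <= X) ->
  bdd_lin_functional L -> L (Ssum a n x) = zsum (fun k => a n k * x k * L (ek k)).
Proof.
move=> hx hL; apply/esym/zsum_unique.
  by have [X hX] := blf_ek_bounded hL; exact: abssumM hX (abssum_mul n hx).
move=> e e0; have [M M0 hM] := blf_bound hL.
pose e' := e / (M + 1); have e'0 : 0 < e' by rewrite divr_gt0//; lra.
have e'E : e' * (M + 1) = e by rewrite mulfVK//; lra.
have [N hN] := Ssum_approx n hx e'0; exists N => m Nm.
have -> : symsum (fun k => a n k * x k * L (ek k)) m =
    L (fun t => symsum (fun k => a n k * x k * ek k t) m).
  by rewrite /symsum (blf_sum _ _ hL)// => i; exact: contT_ek.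
rewrite -(blfB hL (contT_Ssum n hx) (contT_symsum _ m)).
apply: le_trans (hM _ e' _ (hN m Nm)) _.
  by apply: contTB; [exact: contT_Ssum|exact: contT_symsum].
by nra.
Qed.

(** Both sides are the series of a_nk L(e_k) L'(e_k), so the exchange is commutativity of the
    product. All duality formulas are instances. *)
Lemma Ssum_dual n L L' : bdd_lin_functional L -> bdd_lin_functional L' ->
  L (Ssum a n (fun k => L' (ek k))) = L' (Ssum a n (fun k => L (ek k))).
Proof.
move=> hL hL'; rewrite !blf_Ssum//; try exact: blf_ek_bounded.
by congr zsum; apply/funext => k; rewrite mulrAC.
Qed.

Lemma fhat_bounded g : L1T g -> exists X : R, forall k, cabs (fhat g k) <= X.
Proof.
move=> /blf_pairL1l/blf_ek_bounded[X hX]; exists X => k; rewrite -pairL1_ekl; exact: hX.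
Qed.

Lemma contT_Sfhat n g : L1T g -> contT (Ssum a n (fhat g)).
Proof. by move=> /fhat_bounded hg; exact: contT_Ssum. Qed.

Lemma pairM_dual n f (mu : cmeasure R) : contT f ->
  pairL1 f (Ssum a n (muhat mu)) = pairM (Ssum a n (fhat f)) mu.
Proof.
move=> hf; have := Ssum_dual n (blf_pairL1r hf) (blf_pairM mu).
rewrite (_ : (fun k => pairM _ _) = muhat mu); last by apply/funext => k; exact: pairM_ek.
by rewrite (_ : (fun k => pairL1 f _) = fhat f)//; apply/funext => k; exact: pairL1_ekr.
Qed.

Lemma pairL1_dual n f g : contT f -> L1T g ->
  pairL1 f (Ssum a n (fhat g)) = pairL1 (Ssum a n (fhat f)) g.
Proof.
move=> hf hg; have := Ssum_dual n (blf_pairL1r hf) (blf_pairL1l hg).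
rewrite (_ : (fun k => pairL1 _ g) = fhat g); last by apply/funext => k; exact: pairL1_ekl.
by rewrite (_ : (fun k => pairL1 f _) = fhat f)//; apply/funext => k; exact: pairL1_ekr.
Qed.

(** Evaluation at t is a pairing with the continuous convolution kernel of S_n. Linearity and
    boundedness of S_n are then inherited from the integral instead of being proved on series. *)
Lemma Ssum_eval n t g : L1T g ->
  Ssum a n (fhat g) t = pairL1 (Ssum a n (ek ^~ t)) g.
Proof.
move=> hg; have := Ssum_dual n (blf_eval t) (blf_pairL1l hg).
by rewrite (_ : (fun k => pairL1 _ g) = fhat g)//; apply/funext => k; exact: pairL1_ekl.
Qed.

Lemma blf_Ssum_eval n t : bdd_lin_functional (fun f => Ssum a n (fhat f) t).
Proof.
have hk : contT (Ssum a n (ek ^~ t)) by apply: contT_Ssum; exists 1 => k; rewrite cabs_ek.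
have hb := blf_pairL1r hk; split=> [c f g hf hg|].
  have hfg := contT_linear c hf hg.
  by rewrite !Ssum_eval; [exact: (blf_linear c hb)|exact: contT_L1..].
have [M _ hM] := blf_bound hb; exists M => f s hf fs.
by rewrite Ssum_eval; [exact: hM|exact: contT_L1].
Qed.

Lemma zsum_single (c : int -> C) (j : int) : (forall k, k != j -> c k = 0) -> zsum c = c j.
Proof.
move=> hc; have sE m : (`|j| <= m)%N -> symsum c m = c j.
  (* In the sum over 'I_(2m+1) the term of index j sits at position j + m, which is in range once
     |j| <= m. *)
  move=> jm; have jE : (absz (j + m%:Z)%R)%:Z = j + m%:Z by rewrite gez0_abs//; lia.
  have lt : (absz (j + m%:Z)%R < m.*2.+1)%N by lia.
  rewrite /symsum (bigD1 (Ordinal lt))//= jE addrK big1 ?addr0// => i /eqP ij.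
  apply: hc; apply/eqP => ijE; apply: ij; apply: val_inj => /=; lia.
apply: zsum_unique.
  exists (cabs (c j)) => N; have -> : \sum_(i < N.*2.+1) cabs (c (i%:Z - N%:Z)) = asum c N by [].
  apply: le_trans (asum_homo c (leq_maxl N `|j|)) _.
  set m := maxn _ _; have jm : (`|j| <= m)%N := leq_maxr _ _.
  have jE : (absz (j + m%:Z)%R)%:Z = j + m%:Z by rewrite gez0_abs//; lia.
  have lt : (absz (j + m%:Z)%R < m.*2.+1)%N by lia.
  rewrite /asum (bigD1 (Ordinal lt))//= jE addrK big1 ?addr0// => i /eqP ij.
  rewrite hc ?cabs0//; apply/eqP => ijE; apply: ij; apply: val_inj => /=; lia.
by move=> e e0; exists `|j|%N => m /sE ->; rewrite subrr cabs0 ltW.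
Qed.

Lemma Ssum_ek n j t : Ssum a n (fhat (ek j)) t = a n j * ek j t.
Proof.
rewrite /Ssum (zsum_single (j := j)) ?fhat_ek ?eqxx ?mulr1// => k kj.
by rewrite fhat_ek eq_sym (negbTE kj) mulr0 mul0r.
Qed.

Lemma Ssum_shift n f s t : contT f ->
  Ssum a n (fhat (fun u => f (u + s))) t = Ssum a n (fhat f) (t + s).
Proof.
move=> hf; congr zsum; apply/funext => k.
by rewrite fhat_shift// -!/(ek k _) ek_shift; ring.
Qed.

End Multiplier.

(** * Uniform boundedness and completeness *)

Section UniformBoundedness.
Variables (R : realType) (X : Type).
Implicit Types (x y : X -> R) (s : R).

(* [B s x] stands for "x belongs to the Banach space and has norm at most s". *)
Variable B : R -> (X -> R) -> Prop.
Hypothesis B0 : B 0 (fun=> 0).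
Hypothesis B_mono : forall s s' x, s <= s' -> B s x -> B s' x.
Hypothesis B_ge0 : forall s x, B s x -> 0 <= s.
Hypothesis BD : forall s s' x y, B s x -> B s' y -> B (s + s') (fun t => x t + y t).
Hypothesis BZ : forall c s x, B s x -> B (`|c| * s) (fun t => c * x t).
(** Completeness is required only for the series built by the gliding hump. The tail factor 2 is a
    convenient bound for 4/3. *)
Hypothesis B_complete : forall x : nat -> X -> R, x 0%N = (fun=> 0) ->
  (forall j, B (4^-1 ^+ j) (fun t => x j.+1 t - x j t)) ->
  exists y, forall j, B (2 * 4^-1 ^+ j) (fun t => y t - x j t).

Variables (I : Type) (p : I -> (X -> R) -> R).
Hypothesis p_ge0 : forall i x, 0 <= p i x.
Hypothesis pD : forall i s s' x y, B s x -> B s' y ->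
  p i (fun t => x t + y t) <= p i x + p i y.
Hypothesis pZ : forall i c s x, B s x -> p i (fun t => c * x t) = `|c| * p i x.
Hypothesis p_bounded : forall i, exists K : R, forall s x, B s x -> p i x <= K * s.
Hypothesis p_pointwise : forall s x, B s x -> exists M : R, forall i, p i x <= M.

Let BN s x : B s x -> B s (fun t => - x t).
Proof.
move=> hx; have := BZ (-1) hx; rewrite normrN1 mul1r.
by rewrite (_ : (fun t => _) = (fun t => - x t))//; apply/funext => t; rewrite mulN1r.
Qed.

Let pN i s x : B s x -> p i (fun t => - x t) = p i x.
Proof.
move=> hx; have := pZ i (-1) hx; rewrite normrN1 mul1r => <-.
by congr p; apply/funext => t; rewrite mulN1r.
Qed.

Let pB i s s' x y : B s x -> B s' y -> p i (fun t => x t - y t) <= p i x + p i y.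
Proof. by move=> hx hy; have := pD i hx (BN hy); rewrite (pN i hy). Qed.

Let op i := sup [set p i x | x in B 1].

Let op_has_sup i : has_sup [set p i x | x in B 1].
Proof.
split; first by exists (p i (fun=> 0)); exists (fun=> 0) => //=; exact: B_mono B0.
have [K hK] := p_bounded i; exists (K * 1) => _ [x hx <-]; exact: hK.
Qed.

Let op_ge0 i : 0 <= op i.
Proof.
apply: le_trans (p_ge0 i (fun=> 0)) _; apply: (sup_upper_bound (op_has_sup i)).
by exists (fun=> 0) => //=; exact: B_mono B0.
Qed.

Let p_op i s x : B s x -> p i x <= op i * s.
Proof.
(* Normalizing by s^-1 needs s > 0. For s = 0 the crude bound K * 0 already forces the seminorm to
   be at most 0. *)
move=> hx; have := B_ge0 hx; rewrite le_eqVlt => /predU1P[s0|s0].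
  by have [K hK] := p_bounded i; have := hK _ _ hx; rewrite -s0 !mulr0.
have h1 : B 1 (fun t => s^-1 * x t).
  by have := BZ s^-1 hx; rewrite ger0_norm ?invr_ge0 ?ltW// mulVf ?gt_eqF.
have : p i (fun t => s^-1 * x t) <= op i.
  by apply: (sup_upper_bound (op_has_sup i)); exists (fun t => s^-1 * x t).
rewrite (pZ i _ hx) ger0_norm ?invr_ge0 ?(ltW s0)// => h.
by rewrite -ler_pdivrMr// mulrC.
Qed.

(* Gliding hump (Sokal): one of x + r xi, x - r xi is at least as large as r xi
   for the seminorm p i, since their half-difference is r xi. *)
Lemma uniform_boundedness :
  exists M : R, forall i s x, B s x -> p i x <= M * s.
Proof.
apply: contrapT => unb.
(* For each j: an index whose norm on the unit ball is at least 8^j, and a vector of that ball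
   attaining at least 3/4 of this norm. *)
have /choice[u hu] : forall j : nat, exists iz : I * (X -> R),
    [/\ 8 ^+ j <= op iz.1, B 1 iz.2 & 3 / 4 * op iz.1 <= p iz.1 iz.2].
  move=> j; have [i hi] : exists i, 8 ^+ j <= op i.
    apply: contrapT => nop; apply: unb; exists (8 ^+ j) => i s x hx.
    apply: le_trans (p_op i hx) _; rewrite ler_wpM2r ?(B_ge0 hx)//.
    by apply: contrapT => /negP; rewrite -ltNge => /ltW h; apply: nop; exists i.
  have opi : 0 < op i by apply: lt_le_trans hi; rewrite exprn_gt0.
  have e0 : 0 < op i / 4 by rewrite divr_gt0.
  have [_ [z hz <-] hpz] := sup_adherent e0 (op_has_sup i).
  by exists (i, z); split => //=; apply: le_trans (ltW hpz); rewrite -/(op i); lra.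
(* The step sizes 4^-j are summable, yet r_j 8^j = 2^j still diverges. *)
pose r j : R := 4^-1 ^+ j.
have r0 j : 0 <= r j by rewrite exprn_ge0// invr_ge0.
pose xp j (y : X -> R) t := y t + r j * (u j).2 t.
pose xm j (y : X -> R) t := y t - r j * (u j).2 t.
pose F j y := if p (u j).1 (xm j y) <= p (u j).1 (xp j y) then xp j y else xm j y.
pose x := fix x j := if j is j'.+1 then F j' (x j') else fun=> 0.
have Bz j : B (r j) (fun t => r j * (u j).2 t).
  by have [_ h _] := hu j; have := BZ (r j) h; rewrite ger0_norm// mulr1.
have Bstep j : B (r j) (fun t => x j.+1 t - x j t).
  rewrite /= /F; case: ifP => _.
    rewrite (_ : (fun t => _) = (fun t => r j * (u j).2 t))//.
    by apply/funext => t; rewrite /xp addrAC subrr add0r.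
  rewrite (_ : (fun t => _) = (fun t => - (r j * (u j).2 t))); first exact: BN.
  by apply/funext => t; rewrite /xm addrAC subrr add0r.
have Bx j : exists s, B s (x j).
  elim: j => [|j [s IH]]; first by exists 0.
  exists (r j + s); have := BD (Bstep j) IH.
  by rewrite (_ : (fun t => _) = x j.+1)//; apply/funext => t; rewrite subrK.
have [y hy] := B_complete (erefl : x 0%N = _) Bstep.
have By : B 2 y.
  have := hy 0%N; rewrite expr0 mulr1 (_ : (fun t => _) = y)//.
  by apply/funext => t; rewrite subr0.
have [M hM] := p_pointwise By.
(* Step j leaves x_{j+1} with seminorm at least (3/4) r_j [op i], and the later steps together
   remove at most (1/2) r_j [op i]. What remains is at least 8^j r_j / 4 = 2^j / 4. *)
have low j : 2 ^+ j / 4 <= M.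
  have [h8 h1 h34] := hu j; set i := (u j).1 in h8 h34 *.
  have [s hs] := Bx j.
  have hp : 3 / 4 * op i * r j <= p i (x j.+1).
    have Bp : B (s + r j) (xp j (x j)) := BD hs (Bz j).
    have Bm : B (s + r j) (xm j (x j)) := BD hs (BN (Bz j)).
    have := pB i Bp Bm.
    rewrite (_ : (fun t => _) = (fun t => (2 * r j) * (u j).2 t)); last first.
      by apply/funext => t; rewrite /xp /xm; ring.
    rewrite (pZ i _ h1) ger0_norm ?mulr_ge0//.
    have : 3 / 4 * op i * r j <= p i (u j).2 * r j by rewrite ler_wpM2r.
    by rewrite /= /F -/i; case: ifP => [|/negbT]; rewrite -?ltNge; lra.
  have [s' hs'] := Bx j.+1.
  have hq : p i (fun t => y t - x j.+1 t) <= op i * (r j / 2).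
    by apply: le_trans (p_op i (hy j.+1)) _; rewrite exprS -/(r j) ler_wpM2l ?op_ge0//; lra.
  have := pB i By (hy j.+1).
  rewrite (_ : (fun t => _) = x j.+1); last by apply/funext => t; ring.
  have := hM i.
  have -> : 2 ^+ j / 4 = 8 ^+ j * r j / 4 :> R.
    by rewrite /r -exprMn; congr (_ ^+ _ / _); lra.
  have : 8 ^+ j * r j <= op i * r j by rewrite ler_wpM2r.
  lra.
have M4 := archimedean.Num.Theory.truncnS_gt (4 * M).
set k := (Num.trunc (4 * M)).+1 in M4.
have : (k%:R : R) <= 2 ^+ k by rewrite -natrX ler_nat ltnW// ltn_expl.
have := low k; lra.
Qed.

End UniformBoundedness.

(** * Completeness of C(T) and of real L^1 along geometric series *)

Section Completeness.
Variable R : realType.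
Local Notation leb := (@lebesgue_measure R).
Local Notation D := (`[0%R, (pi *+ 2 : R)]%classic).

Lemma geo4_sum j n : \sum_(k < n) 4^-1 ^+ (k + j) <= 2 * 4^-1 ^+ j :> R.
Proof.
suff h : \sum_(k < n) 4^-1 ^+ (k + j) <= 2 * (4^-1 ^+ j - 4^-1 ^+ (n + j)) :> R.
  by apply: le_trans h _; rewrite ler_pM2l// lerBlDr lerDl exprn_ge0// invr_ge0.
elim: n => [|n IH]; first by rewrite big_ord0 add0n subrr mulr0.
rewrite big_ord_recr /= addSn exprS.
have : (0 : R) <= 4^-1 ^+ (n + j) by rewrite exprn_ge0// invr_ge0.
lra.
Qed.

Lemma cvgn_telescope (A y : nat -> R) (M : R) : (forall n, A n <= M) ->
  (forall n, `|y n.+1 - y n| <= A n.+1 - A n) ->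
  cvgn y /\ `|limn y - y 0%N| <= M - A 0%N.
Proof.
move=> AM hy; have cv := cvgn_dominated AM hy; split => //.
have yn n : `|y n - y 0%N| <= M - A 0%N.
  suff : `|y n - y 0%N| <= A n - A 0%N by have := AM n; lra.
  elim: n => [|n IH]; first by rewrite !subrr normr0.
  have := hy n; rewrite (_ : y n.+1 - y 0%N = (y n.+1 - y n) + (y n - y 0%N)); last by ring.
  have := ler_normD (y n.+1 - y n) (y n - y 0%N); lra.
rewrite ler_norml lerBrDr lerBlDr; apply/andP; split.
  by apply: limr_ge => //; exists 0%N => // m _; have := yn m; rewrite /= ler_norml; lra.
by apply: limr_le => //; exists 0%N => // m _; have := yn m; rewrite /= ler_norml; lra.
Qed.

Lemma cvgn_shift (u : nat -> R) i : cvgn (fun n => u (n + i)%N) ->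
  u @ \oo --> limn (fun n => u (n + i)%N).
Proof. by move=> h; rewrite -(cvg_shiftn i). Qed.

Lemma contR_complete (x : nat -> R -> R) : x 0%N = (fun=> 0) ->
  (forall j, contR (fun t => x j.+1 t - x j t) /\
     forall t, `|x j.+1 t - x j t| <= 4^-1 ^+ j) ->
  exists y : R -> R, forall j, contR (fun t => y t - x j t) /\
     forall t, `|y t - x j t| <= 2 * 4^-1 ^+ j.
Proof.
move=> x0 hx; exists (fun t => limn (x ^~ t)) => j.
have cx i : contR (x i).
  elim: i => [|i IH]; first by rewrite x0; exact: contR_cst.
  have := contRD (hx i).1 IH; congr contR; apply/funext => t; exact: subrK.
have main i t : `|limn (x ^~ t) - x i t| <= 2 * 4^-1 ^+ i.
  have step n : `|x (n.+1 + i)%N t - x (n + i)%N t| <=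
      \sum_(k < n.+1) 4^-1 ^+ (k + i) - \sum_(k < n) 4^-1 ^+ (k + i).
    by rewrite big_ord_recr /= addrAC subrr add0r addSn (hx _).2.
  have [cv] := @cvgn_telescope (fun n => \sum_(k < n) 4^-1 ^+ (k + i)) (fun n => x (n + i)%N t)
    _ (geo4_sum i) step.
  by rewrite big_ord0 subr0 add0n (cvg_lim _ (cvgn_shift (u := x ^~ t) cv)).
split=> //; apply: contRB (cx j); apply: contR_lim => e e0.
have [i hi] : exists i, 2 * 4^-1 ^+ i <= e.
  have M4 := archimedean.Num.Theory.truncnS_gt (2 / e).
  set k := (Num.trunc (2 / e)).+1 in M4; exists k.
  have : (k%:R : R) <= 4 ^+ k by rewrite -natrX ler_nat ltnW// ltn_expl.
  move: M4; rewrite ltr_pdivrMr// exprVn -ler_pdivlMr ?invr_gt0 ?exprn_gt0// invrK.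
  by move=> h1 h2; have : k%:R * e <= 4 ^+ k * e by [rewrite ler_pM2r]; lra.
exists (x i) => // t; exact: le_trans (main i t) hi.
Qed.

(** The Riesz-Fischer argument: the series of absolute increments has a finite integral, hence is
    finite almost everywhere, and there the sequence converges with that series as error bound. *)
Lemma L1_complete (x : nat -> R -> R) : x 0%N = (fun=> 0) ->
  (forall j, intR leb D (fun t => x j.+1 t - x j t) /\
     \int[leb]_(t in D) `|x j.+1 t - x j t| <= 4^-1 ^+ j) ->
  exists y : R -> R, forall j, intR leb D (fun t => y t - x j t) /\
     \int[leb]_(t in D) `|y t - x j t| <= 2 * 4^-1 ^+ j.
Proof.
move=> x0 hx.
(* The upper limit is measurable without any convergence; on the exceptional null set its value does
   not matter. *)
pose y t := fine (limn_esup (fun n => (x n t)%:E)); exists y.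
have ix i : intR leb D (x i).
  elim: i => [|i IH]; first by rewrite x0; exact: (contR_int (contR_cst 0)).
  have := intRD measurable_circle (hx i).1 IH; congr (intR _ _ _); apply/funext => t; exact: subrK.
have my : measurable_fun D y.
  apply: (measurableT_comp (fine_measurable measurableT)) => //.
  apply: measurable_fun_limn_esup => n; exact: (measurable_int leb (ix n)).
pose d j k t : \bar R := `|x (k + j).+1 t - x (k + j)%N t|%:E.
pose S j t := (\sum_(0 <= k <oo) d j k t)%E.
have d0 j k t : (0 <= d j k t)%E by rewrite lee_fin.
have md j k : measurable_fun D (d j k).
  by apply: (measurable_int leb); exact: (intR_norm (hx _).1).
have intS j : (\int[leb]_(t in D) S j t <= (2 * 4^-1 ^+ j)%:E)%E.
  rewrite integral_nneseries//; last exact: md.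
  apply: lime_le; first by apply: is_cvg_nneseries => n _ _; exact: integral_ge0.
  apply: nearW => n; rewrite big_mkord.
  apply: (@le_trans _ _ (\sum_(k < n) (4^-1 ^+ (k + j))%:E)%E).
    apply: lee_sum => k _; have [hi hle] := hx (k + j)%N.
    rewrite -[leLHS]fineK ?lee_fin//.
    exact: (integrable_fin_num measurable_circle (intR_norm hi)).
  by rewrite sumEFin lee_fin geo4_sum.
have mS j : measurable_fun D (S j).
  by apply: ge0_emeasurable_sum => // k t Dt _; exact: d0.
have S0 j t : (0 <= S j t)%E by apply: nneseries_ge0 => k _ _; exact: d0.
have iS j : leb.-integrable D (S j).
  apply/integrableP; split; first exact: mS.
  apply: (@le_lt_trans _ _ (\int[leb]_(t in D) S j t)%E); last exact: le_lt_trans (intS j) (ltry _).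
  by under eq_integral do rewrite gee0_abs//.
have ae j : {ae leb, forall t, D t -> (`|y t - x j t|%:E <= S j t)%E}.
  apply: filterS (integrable_ae measurable_circle (iS j)) => t h Dt; have {}h := h Dt.
  have hA n : \sum_(k < n) `|x (k + j).+1 t - x (k + j)%N t| <= fine (S j t).
    rewrite -lee_fin fineK// -sumEFin -(big_mkord xpredT (fun k => d j k t)).
    exact: nneseries_lim_ge.
  have step n : `|x (n.+1 + j)%N t - x (n + j)%N t| <=
      \sum_(k < n.+1) `|x (k + j).+1 t - x (k + j)%N t| -
      \sum_(k < n) `|x (k + j).+1 t - x (k + j)%N t|.
    by rewrite big_ord_recr /= addrAC subrr add0r.
  have [cv] := @cvgn_telescope (fun n => \sum_(k < n) `|x (k + j).+1 t - x (k + j)%N t|)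
    (fun n => x (n + j)%N t) _ hA step.
  rewrite big_ord0 subr0 add0n -lee_fin fineK//; congr (_%:E <= _)%E.
  congr (`|_ - _|); rewrite /y.
  have cvx := cvgn_shift (u := x ^~ t) cv.
  have cvE : (fun n => (x n t)%:E) @ \oo --> (limn (fun n => x (n + j)%N t))%:E.
    by apply/cvg_EFin => //; exact: nearW.
  by rewrite is_cvg_limn_esupE ?(cvg_lim _ cvE)//; apply/cvg_ex; eexists; exact: cvE.
have yx j : (\int[leb]_(t in D) `|y t - x j t|%:E <= (2 * 4^-1 ^+ j)%:E)%E.
  apply: le_trans (intS j); apply: ae_ge0_le_integral => //.
  apply/measurable_EFinP/measurableT_comp => //; apply: measurable_funB => //.
    by apply/measurable_EFinP; exact: (measurable_int leb (ix j)).
  exact: mS.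
have iyx j : intR leb D (fun t => y t - x j t).
  apply/integrableP; split.
    apply/measurable_EFinP/measurable_funB => //.
    by apply/measurable_EFinP; exact: (measurable_int leb (ix j)).
  by apply: le_lt_trans (yx j) (ltry _).
move=> j; split=> //; rewrite -lee_fin fineK//.
exact: (integrable_fin_num measurable_circle (intR_norm (iyx j))).
Qed.

End Completeness.

(** * Continuous functions are dense in L1 *)

Section L1Density.
Variable R : realType.
Local Notation T := (pi *+ 2 : R).
Local Notation leb := (@lebesgue_measure R).
Local Notation D := (`[0%R, (pi *+ 2 : R)]%classic).
Implicit Types (u : R -> R) (t : R).

Let w t : R := 1 - cos t.

Let w_ge0 t : 0 <= w t.
Proof. by rewrite subr_ge0 cos_le1. Qed.

Let contR_w : contR w.
Proof. exact: contRB (contR_cst 1) (contR_cos R). Qed.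

Let w_gt0 t : 0 < t < T -> 0 < w t.
Proof.
move=> t0; rewrite /w (_ : t = t / 2 + t / 2); last by lra.
rewrite cosD; have s0 : 0 < sin (t / 2) by apply: sin_gt0_pi; lra.
by have := cos2Dsin2 (t / 2); nra.
Qed.

(* The 2pi-periodic function equal to the identity on (0, 2pi):
   sin t / (1 - cos t) = cot (t / 2). *)
Let saw t : R := pi - 2 * atan (sin t / w t).

Let saw_itv t : saw t \in `[0, T].
Proof.
rewrite in_itv /= /saw; have := atan_gtNpi2 (sin t / w t); have := atan_ltpi2 (sin t / w t).
by move=> h1 h2; apply/andP; split; lra.
Qed.

Let sawE t : 0 < t < T -> saw t = t.
Proof.
move=> t0; have s0 : 0 < sin (t / 2) by apply: sin_gt0_pi; lra.
have e1 : sin t / w t = cos (t / 2) / sin (t / 2).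
  have wn0 : w t != 0 by rewrite gt_eqF ?w_gt0.
  have sn0 : sin (t / 2) != 0 by rewrite gt_eqF.
  have tE : t = t / 2 + t / 2 by lra.
  have eS : sin t = sin (t / 2) * cos (t / 2) + cos (t / 2) * sin (t / 2).
    by rewrite {1}tE sinD.
  have eC : cos t = cos (t / 2) * cos (t / 2) - sin (t / 2) * sin (t / 2).
    by rewrite {1}tE cosD.
  apply/eqP; rewrite eqr_div//; apply/eqP.
  have -> : w t = 2 * sin (t / 2) ^+ 2 by rewrite /w eC; have := cos2Dsin2 (t / 2); lra.
  by rewrite eS; ring.
have e2 : cos (t / 2) / sin (t / 2) = tan ((pi - t) / 2).
  rewrite /tan (_ : (pi - t) / 2 = pi / 2 - t / 2); last by lra.
  by rewrite sinB cosB sin_pihalf cos_pihalf !mul0r !mul1r subr0 add0r.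
rewrite /saw e1 e2 tanK ?in_itv/=; first by lra.
by apply/andP; split; lra.
Qed.

(** A continuous factor vanishing at the jumps of [saw]; the defect 1 - [cut n t] = 1 / (1 + n w(t))
    tends to 0 everywhere else. *)
Let cut n t : R := n%:R * w t / (1 + n%:R * w t).

Let den_ge1 n t : 1 <= 1 + n%:R * w t.
Proof. by rewrite lerDl mulr_ge0. Qed.

Let den_gt0 n t : 0 < 1 + n%:R * w t.
Proof. exact: lt_le_trans (den_ge1 n t). Qed.

Let contR_den n : contR (fun t => 1 + n%:R * w t).
Proof. exact: contRD (contR_cst 1) (contRM (contR_cst _) contR_w). Qed.

Let contR_cut n : contR (cut n).
Proof.
apply: contRM; first exact: contRM (contR_cst _) contR_w.
by apply: contR_inv => // t; rewrite gt_eqF.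
Qed.

Let contR_saw_cut u n : continuous u -> contR (fun t => u (saw t) * cut n t).
Proof.
move=> cu; have ab : 0 <= T := ltW (T_gt0 R).
have cw : {within `[0, T], continuous (fun t => `|u t|)}.
  by apply: continuous_subspaceT => t; apply: cvg_norm; exact: cu.
have [c _ hc] := EVT_max ab cw; set M : R := `|u c| in hc.
have M0 : 0 <= M := normr_ge0 _.
have uM t : `|u (saw t)| <= M by apply: hc; exact: saw_itv.
split=> t; first by rewrite /saw /cut !(contR_w).1 (contR_sin R).1.
(* Where [w] is nonzero everything is continuous. At a zero of [w] the function [saw] jumps, but
   u(saw) stays bounded by [M] and the factor [cut] tends to 0. *)
have [w0|w0] := eqVneq (w t) 0; last first.
  apply: cvgM; last exact: (contR_cut n).2.
  apply: (@continuous_comp _ _ _ saw u); last exact: cu.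
  apply: cvgB; first exact: cvg_cst.
  apply: cvgM; first exact: cvg_cst.
  apply: (@continuous_comp _ _ _ (fun t => sin t / w t) atan); last exact: continuous_atan.
  apply: cvgM; first exact: continuous_sin.
  by apply: cvgV => //; exact: contR_w.2.
rewrite /continuous_at {2}/cut w0 mulr0 mul0r mulr0.
apply/cvgrPdist_le => e e0.
have e1 : 0 < e / (M + 1) by rewrite divr_gt0// ltr_wpDl.
have := (contR_cut n).2 t => /cvgrPdist_le/(_ _ e1).
apply: filterS => s; rewrite {1}/cut w0 mulr0 mul0r !sub0r !normrN => hs.
rewrite [leLHS]normrM; apply: (@le_trans _ _ (M * (e / (M + 1)))); first by rewrite ler_pM.
by rewrite mulrA ler_pdivrMr ?ltr_wpDl// mulrC ler_pM2l// lerDl.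
Qed.

(** The integrand is M (1 - [cut n t]), the error of cutting off a function bounded by [M]. It is
    dominated by |M| and tends to 0 except at the two endpoints. *)
Lemma cut_tail (M : R) :
  (fun n => \int[leb]_(t in D) (M / (1 + n%:R * w t))) @ \oo --> (0 : R).
Proof.
pose f_ n t := (M / (1 + n%:R * w t))%:E.
have hc n : contR (fun t => M / (1 + n%:R * w t)).
  by apply: contRM (contR_cst _) (contR_inv _ _) => // t; rewrite gt_eqF.
have mf n : measurable_fun D (f_ n) by exact: (measurable_int leb (contR_int (hc n))).
have cv : {ae leb, forall t, D t -> f_ ^~ t @ \oo --> (0 : \bar R)%E}.
  exists [set 0; T]; split.
  - by apply: measurableU; exact: measurable_set1.
  - by apply: countable_lebesgue_measure0; exact: finite_set_countable.
  - move=> t /= /not_implyP[Dt nc]; apply: contrapT => t0T; apply: nc.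
    apply: cvg_EFin; first exact: nearW.
    have wt : 0 < w t.
      apply: w_gt0; move: Dt; rewrite in_itv/= => /andP[h1 h2].
      rewrite !lt_neqAle h1 h2 !andbT; apply/andP; split; apply/eqP => h; apply: t0T.
        by left.
      by right.
    apply/cvgrPdist_le => e e0; near=> n.
    rewrite sub0r normrN normrM normfV (gtr0_norm (den_gt0 _ _)) ler_pdivrMr//.
    have : `|M| / (e * w t) <= n%:R by near: n; exact: nbhs_infty_ger.
    rewrite ler_pdivrMr ?mulr_gt0// => h; apply: le_trans h _.
    have := ltW e0; lra.
have ig : leb.-integrable D (cst `|M|%:E) by exact: (contR_int (contR_cst _)).
have [] := dominated_convergence measurable_circle mf (measurable_cst _) cv ig _.
  apply: aeW => t n _; rewrite lee_fin normrM normfV (gtr0_norm (den_gt0 _ _)).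
  by rewrite ler_pdivrMr// ler_peMr.
move=> _ _; rewrite integral0 => h.
exact: (fine_cvg h).
Unshelve. all: by end_near. Qed.

(** A continuous approximant on the line need not be periodic. Composing it with [saw] makes it so,
    and [cut] repairs the jump at the cost of a small integral. *)
Lemma contR_L1_dense u (e : R) : intR leb D u -> 0 < e ->
  exists v, contR v /\ \int[leb]_(t in D) `|u t - v t| <= e.
Proof.
move=> iu e0; have e20 : 0 < e / 2 by rewrite divr_gt0.
have Dfin : (leb D < +oo)%E by rewrite lebesgue_measure_itv/= lte_fin T_gt0 ltry.
have [g_ [cg ig hg]] := approximation_continuous_integrable measurable_circle Dfin iu.
have [phi [cphi iphi hphi]] : exists phi, [/\ continuous phi, intR leb D phi &
    \int[leb]_(t in D) `|u t - phi t| <= e / 2].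
  have /cvgrPdist_le/(_ _ e20)[N _ hN] :
    (fun n => \int[leb]_(t in D) `|u t - g_ n t|) @ \oo --> (0 : R) by exact: fine_cvg.
  exists (g_ N); split => //; first exact: ig.
  by have := hN N (leqnn N); rewrite /= sub0r normrN; apply: le_trans; exact: ler_norm.
have ab : 0 <= T := ltW (T_gt0 R).
have cw : {within `[0, T], continuous (fun t => `|phi t|)}.
  by apply: continuous_subspaceT => t; apply: cvg_norm; exact: cphi.
have [c _ hc] := EVT_max ab cw; set M : R := `|phi c| in hc.
have /cvgrPdist_le/(_ _ e20)[N _ hN] := cut_tail M.
exists (fun t => phi (saw t) * cut N t).
have hv := contR_saw_cut N cphi; split=> //.
have hden : contR (fun t => M / (1 + N%:R * w t)).
  by apply: contRM (contR_cst _) (contR_inv _ _) => // t; rewrite gt_eqF.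
apply: (@le_trans _ _ (\int[leb]_(t in D) (`|u t - phi t| + M / (1 + N%:R * w t)))).
  apply: le_Rintegral => //; first exact: (intR_norm (intRB measurable_circle iu (contR_int hv))).
    exact: (intRD measurable_circle (intR_norm (intRB measurable_circle iu iphi)) (contR_int hden)).
  move=> t Dt; apply: le_trans (ler_distD (phi t) _ _) _; rewrite lerD2l.
  move: (Dt); rewrite /= in_itv/= => /andP[h1 h2].
  have hM : `|phi t| <= M by apply: hc.
  have M0 : 0 <= M := normr_ge0 _.
  have [tI|/negP tN] := boolP (0 < t < T).
    rewrite sawE// (_ : _ - _ = phi t / (1 + N%:R * w t)).
      by rewrite normrM normfV (gtr0_norm (den_gt0 _ _)) ler_pM2r ?invr_gt0.
    by rewrite /cut; field; rewrite gt_eqF.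
  (* At the endpoints the cut function is 0 and the error bound is the whole of [M], so the
     pointwise estimate holds on all of [0, T]. *)
  have wt : w t = 0.
    rewrite /w; move: h1 h2; rewrite !le_eqVlt => /predU1P[<-|t0].
      by rewrite cos0 subrr.
    by move=> /predU1P[->|tT]; [rewrite cos2pi subrr|case: tN; rewrite t0].
  by rewrite /cut wt mulr0 mul0r mulr0 subr0 addr0 divr1.
rewrite RintegralD//; [|exact: (intR_norm (intRB measurable_circle iu iphi))|exact: (contR_int hden)].
have := hN N (leqnn N); rewrite /= sub0r normrN => h.
have := le_trans (ler_norm _) h; lra.
Qed.

End L1Density.

(** * The equivalences *)

Section DiracMass.
Variable R : realType.
Local Notation T := (pi *+ 2 : R).

Let dirac0 : {finite_measure set (measurableTypeR R) -> \bar R} :=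
  @dirac _ (measurableTypeR R) 0 R.
Let null : {finite_measure set (measurableTypeR R) -> \bar R} :=
  @mzero _ (measurableTypeR R) R.

Let dirac0_supp : dirac0 (~` `[0%R, T[) = 0%E.
Proof.
rewrite /dirac0 /= diracE memNset// => /=; apply; rewrite in_itv/= lexx /=; exact: T_gt0.
Qed.

Definition delta0 : cmeasure R := @CMeasure R dirac0 null null null dirac0_supp erefl erefl erefl.

Lemma pairM_delta0 f : contT f -> pairM f delta0 = f 0.
Proof.
move=> hf; have hf' := contT_opp hf.
have z u : cintm null u = 0.
  by apply: eqC; rewrite ?cRe_parts ?cIm_parts /Rintegral integral_measure_zero.
rewrite /pairM /cintmu /delta0 /= !z !subr0 mulr0 addr0.
have d u : contR u -> \int[dirac0]_(t in setT) u t = u 0.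
  move=> hu; rewrite /Rintegral integral_dirac//=; last first.
    by apply/measurable_EFinP; exact: contR_measurable.
  by rewrite indicT mul1r.
apply: eqC; rewrite ?cRe_parts ?cIm_parts.
  by rewrite (d _ (contT_Re hf')) oppr0.
by rewrite (d _ (contT_Im hf')) oppr0.
Qed.

End DiracMass.

Section Equivalences.
Variables (R : realType) (a : nat -> int -> R[i]) (ha : forall n, abssum (a n)).
Local Notation C := R[i].
Local Notation T := (pi *+ 2 : R).
Local Notation leb := (@lebesgue_measure R).
Local Notation D := (`[0%R, (pi *+ 2 : R)]%classic).
Local Notation ek := (@ek R).
Local Notation S n f := (Ssum a n (fhat f)).
Implicit Types (f g h : R -> C) (x : R -> R).

Lemma ccvg_bounded (u : nat -> C) l : ccvg u l -> exists M : R, forall n, cabs (u n) <= M.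
Proof.
move=> /ccvgP/(_ 1 ltr01)[N hN]; exists (1 + cabs l + \sum_(i < N) cabs (u i)) => n.
have s0 (P : pred 'I_N) : 0 <= \sum_(i < N | P i) cabs (u i).
  by apply: sumr_ge0 => i _; exact: cabs_ge0.
have [Nn|nN] := leqP N n.
  have := cabsD (u n - l) l; rewrite subrK; have := hN n Nn; have := s0 xpredT; lra.
rewrite (bigD1 (Ordinal nN)) //=; have := s0 (fun i => i != Ordinal nN).
have := cabs_ge0 l; lra.
Qed.

Lemma contT_real x : contR x -> contT (fun t => (x t)%:C%C).
Proof. by move=> hx; apply/contTE; split => //; exact: contR_cst. Qed.

Lemma L1T_real x : intR leb D x -> L1T (fun t => (x t)%:C%C).
Proof. by move=> hx; split => //; exact: (contR_int (contR_cst 0)). Qed.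

Let bounded := exists2 M : R, 0 <= M & forall n f s, contT f -> (forall t, cabs (f t) <= s) ->
  forall t, cabs (S n f t) <= M * s.

Let pointwise := forall k, ccvg (a ^~ k) 1.

Let uniform := forall f, contT f -> forall e : R, 0 < e ->
  exists N : nat, forall n, (N <= n)%N -> forall t : R, cabs (S n f t - f t) <= e.

(** The point 0 suffices because S_n commutes with translations, which preserve the sup-norm. *)
Lemma bounded_at0 : (forall f, contT f -> exists M : R, forall n, cabs (S n f 0) <= M) -> bounded.
Proof.
move=> hbd.
pose B s x := contR x /\ forall t, `|x t| <= s.
pose p n x := cabs (S n (fun t => (x t)%:C%C) 0).
have L n := blf_Ssum_eval ha n 0.
have [M hM] : exists M : R, forall n s x, B s x -> p n x <= M * s.
  apply: uniform_boundedness => //.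
  - by split; [exact: contR_cst|move=> t; rewrite normr0].
  - by move=> s s' x ss' [hx xs]; split=> // t; exact: le_trans (xs t) ss'.
  - by move=> s x [_ xs]; exact: le_trans (normr_ge0 _) (xs 0).
  - move=> s s' x y [hx xs] [hy ys]; split; first exact: contRD.
    by move=> t; apply: le_trans (ler_normD _ _) _; exact: lerD.
  - move=> c s x [hx xs]; split; first exact: contRM (contR_cst _) hx.
    by move=> t; rewrite normrM ler_wpM2l.
  - exact: contR_complete.
  - by move=> n x; exact: cabs_ge0.
  - move=> n s s' x y [hx _] [hy _]; rewrite /p.
    have -> : (fun t => (x t + y t)%:C%C) = (fun t => 1 * (x t)%:C%C + (y t)%:C%C).
      by apply/funext => t; rewrite mul1r rmorphD.
    by rewrite (blf_linear _ (L n))// ?mul1r ?cabsD//; exact: contT_real.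
  - move=> n c s x [hx _]; rewrite /p.
    under eq_fun do rewrite rmorphM.
    by rewrite (blfZ _ (L n)) ?cabsM ?cabs_real//; exact: contT_real.
  - move=> n; have [K _ hK] := blf_bound (L n); exists K => s x [hx xs].
    by apply: hK => [|t]; [exact: contT_real|rewrite cabs_real].
  - by move=> s x [hx _]; apply: hbd; exact: contT_real.
(* One |M| for the real part and one for the imaginary part; the absolute value is there because [M]
   comes without a sign. *)
exists (2 * `|M|); first by rewrite mulr_ge0.
move=> n f s hf fs t; rewrite -[t]add0r -Ssum_shift//.
set g := (fun u => f (u + t)); have hg : contT g := contT_shift t hf.
have gE : g = (fun u => 'i%C * (cIm (g u))%:C%C + (cRe (g u))%:C%C).
  by apply/funext => u; rewrite addrC; apply: eqC; rewrite ?cRe_parts ?cIm_parts.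
have s0 : 0 <= s := le_trans (cabs_ge0 _) (fs 0).
have key y : contR y -> (forall u, `|y u| <= s) -> p n y <= `|M| * s.
  by move=> hy ys; apply: le_trans (hM n s y (conj hy ys)) _; rewrite ler_wpM2r ?ler_norm.
have hr := key _ (contT_Re hg) (fun u => le_trans (cRe_le (g u)) (fs _)).
have hi := key _ (contT_Im hg) (fun u => le_trans (cIm_le (g u)) (fs _)).
rewrite gE (blf_linear _ (L n)); last 2 first.
- exact/contT_real/contT_Im.
- exact/contT_real/contT_Re.
apply: le_trans (cabsD _ _) _; rewrite cabsM (_ : cabs 'i%C = 1).
  rewrite mul1r; apply: le_trans (lerD hi hr) _.
  by rewrite -mulrA mulr_natl mulr2n.
by rewrite /cabs /= expr0n expr1n add0r sqrtr1.
Qed.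

Lemma uniform_of_bounded : bounded -> pointwise -> uniform.
Proof.
move=> [M M0 hM] hp; apply: contT_ind => [k e e0|c f g hf hg IHf IHg e e0|f hf hd e e0].
- have [N hN] := (ccvgP _ _).1 (hp k) e e0; exists N => n Nn t.
  by rewrite Ssum_ek// -{2}[ek k t]mul1r -mulrBl cabsM cabs_ek mulr1 hN.
- pose e' := e / (cabs c + 1); have c0 := cabs_ge0 c.
  have e'0 : 0 < e' by rewrite divr_gt0//; lra.
  have e'E : e' * (cabs c + 1) = e by rewrite mulfVK//; lra.
  have [N hN] := IHf _ e'0; have [N' hN'] := IHg _ e'0.
  exists (maxn N N') => n; rewrite geq_max => /andP[Nn N'n] t.
  rewrite (blf_linear c (blf_Ssum_eval ha n t) hf hg).
  have -> (x y z w : C) : c * x + y - (c * z + w) = c * (x - z) + (y - w) by ring.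
  apply: le_trans (cabsD _ _) _; rewrite cabsM.
  apply: le_trans (lerD (ler_wpM2l c0 (hN n Nn t)) (hN' n N'n t)) _; lra.
(* The three errors are M e' for S_n(f - g), e' for S_n g - g and e' for f - g. *)
- pose e' := e / (M + 2); have e'0 : 0 < e' by rewrite divr_gt0//; lra.
  have e'E : e' * (M + 2) = e by rewrite mulfVK//; lra.
  have [g [hg IHg fg]] := hd _ e'0; have [N hN] := IHg _ e'0.
  exists N => n Nn t; have hfg := contTB hf hg.
  have E : S n (fun u => f u - g u) t = S n f t - S n g t.
    exact: (blfB (blf_Ssum_eval ha n t) hf hg).
  have -> : S n f t - f t = S n (fun u => f u - g u) t + (S n g t - g t) - (f t - g t).
    by rewrite E; move: (S n f t) (S n g t) (f t) (g t) => x y z w; ring.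
  apply: le_trans (cabsD _ _) _; rewrite cabsN.
  apply: le_trans (lerD (le_trans (cabsD _ _) (lerD (hM n _ e' hfg fg t) (hN n Nn t))) (fg t)) _.
  lra.
Qed.

Lemma blf_ccvg f L : uniform -> contT f -> bdd_lin_functional L ->
  ccvg (fun n => L (S n f)) (L f).
Proof.
move=> hu hf hL; have [M M0 hM] := blf_bound hL.
apply/ccvgP => e e0; pose e' := e / (M + 1).
have e'0 : 0 < e' by rewrite divr_gt0//; lra.
have e'E : e' * (M + 1) = e by rewrite mulfVK//; lra.
have [N hN] := hu f hf e' e'0; exists N => n Nn.
have hS := contT_Sfhat ha n (contT_L1 hf).
rewrite -(blfB hL hS hf); apply: le_trans (hM _ _ (contTB hS hf) (hN n Nn)) _; lra.
Qed.

Let weak_L1 := forall g, L1T g -> forall f, contT f ->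
  ccvg (fun n => pairL1 f (S n g)) (pairL1 f g).

Lemma pairL1_fejer h n : contT h ->
  pairL1 h (fun s => (fejer n (0 - s))%:C%C) = fejer_sum n (fun s => h (- s)) 0.
Proof. by move=> hh; rewrite fejer_sumE//; exact: contT_opp. Qed.

(* Two applications of the uniform boundedness principle: on real L^1 for fixed f,
   then on the continuous functions. *)
Lemma weak_L1_bounded : weak_L1 -> bounded.
Proof.
move=> hw; apply: bounded_at0 => f hf.
have hS n : contT (S n f) := contT_Sfhat ha n (contT_L1 hf).
pose B s x := intR leb D x /\ \int[leb]_(t in D) `|x t| <= s.
pose p n x := cabs (pairL1 (S n f) (fun t => (x t)%:C%C)).
have L1M n x : intR leb D x -> L1T (fun t => S n f (- t) * (x t)%:C%C).
  by move=> hx; apply: L1T_bounded_mul (L1T_real hx); exact: contT_opp.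
have [M hM] : exists M : R, forall n s x, B s x -> p n x <= M * s.
  apply: uniform_boundedness => //.
  - split; first exact: (contR_int (contR_cst 0)).
    by under eq_Rintegral do rewrite normr0; rewrite Rintegral_cst ?mul0r//; exact: measurable_circle.
  - by move=> s s' x ss' [hx xs]; split=> //; exact: le_trans xs ss'.
  - by move=> s x [_ xs]; apply: le_trans xs; apply: Rintegral_ge0.
  - move=> s s' x y [hx xs] [hy ys]; have hxy := intRD measurable_circle hx hy; split=> //.
    apply: le_trans (lerD xs ys); rewrite -RintegralD//; try exact: intR_norm.
    apply: le_Rintegral => //; [exact: intR_norm| |by move=> t _; exact: ler_normD].
    exact: (intRD measurable_circle (intR_norm hx) (intR_norm hy)).
  - move=> c s x [hx xs]; split; first exact: (intRZ measurable_circle c hx).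
    under eq_Rintegral do rewrite normrM.
    by rewrite RintegralZl ?ler_wpM2l//; [exact: intR_norm].
  - exact: L1_complete.
  - by move=> n x; exact: cabs_ge0.
  - move=> n s s' x y [hx _] [hy _]; rewrite /p /pairL1.
    apply: le_trans (cabsD _ _); rewrite -[X in _ <= cabs (X + _)]mul1r -cint_linear; try exact: L1M.
    have -> // : (fun t => S n f (- t) * (x t + y t)%:C%C) =
      (fun t => 1 * (S n f (- t) * (x t)%:C%C) + S n f (- t) * (y t)%:C%C).
    by apply/funext => t; rewrite mul1r rmorphD mulrDr.
  - move=> n c s x [hx _]; rewrite /p /pairL1 -cabs_real -cabsM.
    have h0 : cint (fun=> 0 : C) = 0.
      by apply: cabs_eq0; apply/le_anti; rewrite cabs_ge0 andbT -[leRHS](mulr0 2);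
         apply: cint_le_cst => [|t]; [exact/contT_L1/contT_cst|rewrite cabs0].
    rewrite -[X in _ = cabs X]addr0 -h0 -cint_linear; [|exact: L1M|exact/contT_L1/contT_cst].
    by congr (cabs (cint _)); apply/funext => t; rewrite addr0 rmorphM mulrCA.
  - move=> n; have [K hK] := contT_bounded (hS n).
    have K0 : 0 <= K := le_trans (cabs_ge0 _) (hK 0).
    exists (2 * T^-1 * K) => s x [hx xs].
    apply: le_trans (pairL1_le (L1T_real hx) (hS n) hK) _; rewrite nrm1_real mulrAC.
    by rewrite ler_wpM2l ?mulr_ge0 ?invr_ge0 ?(ltW (T_gt0 R)).
  - move=> s x [hx _]; have := hw _ (L1T_real hx) f hf.
    move=> /ccvg_bounded[K hK]; exists K => n; rewrite /p -(pairL1_dual ha)//.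
    exact: L1T_real.
(* The Fejer kernel has unnormalized L^1 norm T, so its pairing with S_n f is at most |M| T. This
   pairing is a Fejer mean, within 1 of S_n f (0) for a suitable [m]; that [m] depends on n, the
   bound does not. *)
exists (`|M| * T + 1) => n.
have [m hm] := fejer_approx (contT_opp (hS n)) ltr01.
have := hm 0; rewrite -pairL1_fejer// oppr0 => h1.
have := cabsD (S n f 0 - pairL1 (S n f) (fun s => (fejer m (0 - s))%:C%C))
  (pairL1 (S n f) (fun s => (fejer m (0 - s))%:C%C)); rewrite subrK.
have hF : B T (fun s => fejer m (0 - s)).
  split; first exact: (contR_int (contT_Re (contT_fejer m 0))).
  under eq_Rintegral do rewrite ger0_norm ?fejer_ge0//.
  have := congr1 (@cRe R) (fejer_mean m 0); rewrite cRe_parts => /(congr1 ( *%R T)).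
  by rewrite mulrA mulfV ?gt_eqF ?T_gt0// mul1r mulr1 => ->.
have := hM n _ _ hF; rewrite /p; have := ler_wpM2r (ltW (T_gt0 R)) (ler_norm M); lra.
Qed.

Lemma weak_L1_pointwise : weak_L1 -> pointwise.
Proof.
move=> hw k; have := hw _ (contT_L1 (contT_ek R k)) _ (contT_ek R k).
rewrite pairL1_ekl fhat_ek eqxx (_ : (fun n => _) = a ^~ k)//.
apply/funext => n.
rewrite (_ : S n (ek k) = (fun t => a n k * ek k t)); last by apply/funext => t; exact: Ssum_ek.
rewrite (blfZ _ (blf_pairL1r (contT_ek R k)) (contT_ek R k)).
by rewrite pairL1_ekl fhat_ek eqxx mulr1.
Qed.

(** Real and imaginary parts are tested separately, each against a continuous substitute for its
    sign. Each contributes T K, the T undoing the normalization of [cint]. *)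
Lemma nrm1_dual h (K : R) : contT h ->
  (forall f, contT f -> (forall t, cabs (f t) <= 1) -> cabs (pairL1 f h) <= K) ->
  nrm1 h <= 2 * T * K.
Proof.
move=> hh hK; have T0 := T_gt0 R.
have key (q : C -> R) (qM : forall (x : R) z, q (x%:C%C * z) = x * q z)
    (qle : forall z, `|q z| <= cabs z)
    (qint : forall g, q (cint g) = T^-1 * \int[leb]_(t in D) q (g t))
    (hq : contR (fun t => q (h t))) : \int[leb]_(t in D) `|q (h t)| <= T * K.
  apply/ler_addgt0Pl => e e0; pose e' := e / T; have e'0 : 0 < e' by rewrite divr_gt0.
  set u := (fun t => q (h t)) in hq *.
  have d0 t : 0 < `|u t| + e' by rewrite ltr_wpDl.
  (* A continuous approximate sign: |v| <= 1, and v u >= |u| - e' because (|u| - e')(|u| + e') <=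
     u^2. *)
  pose v t := u t / (`|u t| + e').
  have hv : contR v.
    apply: contRM => //; apply: contR_inv; first exact: contRD (contR_norm hq) (contR_cst _).
    by move=> t; rewrite gt_eqF.
  have v1 t : `|v t| <= 1.
    rewrite normrM normfV (gtr0_norm (d0 t)) ler_pdivrMr// mul1r lerDl; exact: ltW.
  have := hK _ (contT_real (contR_opp hv)) (fun t => ltac:(by rewrite cabs_real)).
  move=> /(le_trans (le_trans (ler_norm _) (qle _))); rewrite qint.
  have -> : \int[leb]_(t in D) q ((v (- - t))%:C%C * h t) = \int[leb]_(t in D) (v t * u t).
    by apply: eq_Rintegral => t _; rewrite opprK qM.
  move=> hK'.
  have : \int[leb]_(t in D) (`|u t| - e') <= \int[leb]_(t in D) (v t * u t).
    apply: le_Rintegral.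
    - exact: measurable_circle.
    - exact: (contR_int (contRB (contR_norm hq) (contR_cst _))).
    - exact: (contR_int (contRM hv hq)).
    move=> t _; rewrite /v mulrAC ler_pdivlMr//.
    have : `|u t| ^+ 2 = u t * u t by rewrite real_normK ?num_real.
    by nra.
  rewrite RintegralB; last 3 first.
  - exact: measurable_circle.
  - exact: (contR_int (contR_norm hq)).
  - exact: (contR_int (contR_cst _)).
  have <- : T * (T^-1 * \int[leb]_(t in D) e') = \int[leb]_(t in D) e'.
    by rewrite mulrA mulfV ?gt_eqF// mul1r.
  rewrite mean_cst (_ : T * e' = e); last by rewrite mulrC divfK// gt_eqF.
  have : T * (T^-1 * \int[leb]_(t in D) (v t * u t)) <= T * K by rewrite ler_pM2l.
  rewrite mulrA mulfV ?gt_eqF// mul1r => h1 h2.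
  by rewrite -lerBlDl; exact: le_trans h2 h1.
have hr : \int[leb]_(t in D) `|cRe (h t)| <= T * K.
  apply: key; [|exact: cRe_le| |exact: contT_Re].
  - by move=> x [y z]; rewrite cReM /cRe /cIm /=; ring.
  - by move=> g; rewrite cRe_parts.
have hi : \int[leb]_(t in D) `|cIm (h t)| <= T * K.
  apply: key; [|exact: cIm_le| |exact: contT_Im].
  - by move=> x [y z]; rewrite cImM /cRe /cIm /=; ring.
  - by move=> g; rewrite cIm_parts.
rewrite /nrm1 RintegralD; [lra|exact: measurable_circle| |].
- exact: (contR_int (contR_norm (contT_Re hh))).
- exact: (contR_int (contR_norm (contT_Im hh))).
Qed.

(** The adjoint bound: S_n is moved onto the test function, giving (2 / T) M times the norm of g,
    and [nrm1_dual] multiplies by 2T. *)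
Lemma nrm1_Ssum_le (M : R) : 0 <= M ->
  (forall n f s, contT f -> (forall t, cabs (f t) <= s) -> forall t, cabs (S n f t) <= M * s) ->
  forall n g, L1T g -> nrm1 (S n g) <= 4 * M * nrm1 g.
Proof.
move=> M0 hM n g hg; have T0 := T_gt0 R.
apply: le_trans (nrm1_dual (K := 2 * T^-1 * nrm1 g * M) (contT_Sfhat ha n hg) _) _.
  move=> f hf f1; rewrite (pairL1_dual ha)//.
  apply: pairL1_le => //; first exact: (contT_Sfhat ha n (contT_L1 hf)).
  by move=> t; rewrite -[M]mulr1; exact: hM.
suff -> : 2 * T * (2 * T^-1 * nrm1 g * M) = 4 * M * nrm1 g by [].
by move: (nrm1 g) (T : R) T0 => x y y0; field; rewrite gt_eqF.
Qed.

Lemma contT_L1_dense g (e : R) : L1T g -> 0 < e ->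
  exists f, contT f /\ nrm1 (fun t => g t - f t) <= e.
Proof.
move=> hg e0; have [g1 g2] : intC leb D g := hg.
have e20 : 0 < e / 2 by rewrite divr_gt0.
have [u [hu gu]] := contR_L1_dense g1 e20; have [v [hv gv]] := contR_L1_dense g2 e20.
exists (fun t => Complex (u t) (v t)); split; first exact/contTE.
have -> : nrm1 (fun t => g t - Complex (u t) (v t)) =
    \int[leb]_(t in D) (`|cRe (g t) - u t| + `|cIm (g t) - v t|).
  by apply: eq_Rintegral => t _; rewrite cReD cImD cReN cImN.
rewrite RintegralD; last 3 first.
- exact: measurable_circle.
- exact: (intR_norm (intRB measurable_circle g1 (contR_int hu))).
- exact: (intR_norm (intRB measurable_circle g2 (contR_int hv))).
lra.
Qed.

Lemma intR_cabs h : L1T h -> intR leb D (fun t => cabs (h t)).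
Proof.
move=> hh; have [h1 h2] : intC leb D h := hh.
apply: (le_integrable measurable_circle _ _ (intR_nrm1 hh)).
  have m1 : measurable_fun D (fun t => cRe (h t)).
    by apply/measurable_EFinP; exact: (measurable_int leb h1).
  have m2 : measurable_fun D (fun t => cIm (h t)).
    by apply/measurable_EFinP; exact: (measurable_int leb h2).
  apply/measurable_EFinP.
  have -> : (fun t => cabs (h t)) = Num.sqrt \o (fun t => cRe (h t) ^+ 2 + cIm (h t) ^+ 2).
    by apply/funext => t /=; rewrite /cabs /cRe /cIm; case: (h t).
  apply: measurableT_comp.
    by apply: continuous_measurable_fun; exact: sqrt_continuous.
  by apply: measurable_funD; exact: measurable_funX.
move=> t _; rewrite lee_fin ger0_norm ?cabs_ge0// ger0_norm ?addr_ge0//.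
exact: cabs_le.
Qed.

Lemma L1TB g h : L1T g -> L1T h -> L1T (fun t => g t - h t).
Proof.
move=> hg hh; have := intC_linear measurable_circle (-1) hh hg.
by rewrite (_ : (fun t => _) = (fun t => g t - h t))//; apply/funext => t; rewrite mulN1r addrC.
Qed.

Lemma Ssum_fhatB n g h t : L1T g -> L1T h ->
  S n (fun u => g u - h u) t = S n g t - S n h t.
Proof.
move=> hg hh; rewrite !(Ssum_eval ha)//; last exact: L1TB.
have hk : contT (Ssum a n (ek ^~ t)) by apply: contT_Ssum => //; exists 1 => k; rewrite cabs_ek.
have L f : L1T f -> L1T (fun u => Ssum a n (ek ^~ t) (- u) * f u).
  by move=> hf; apply: L1T_bounded_mul hf; exact: contT_opp.
rewrite /pairL1 -mulN1r addrC -cint_linear; try exact: L.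
by congr cint; apply/funext => u; rewrite mulrBr mulN1r addrC.
Qed.

Lemma strong_L1 : bounded -> uniform -> forall g, L1T g ->
  (fun n => \int[leb]_(t in D) cabs (S n g t - g t)) @ \oo --> (0 : R).
Proof.
move=> [M M0 hM] hu g hg; have T0 := T_gt0 R.
apply/cvgrPdist_le => e e0.
(* With f continuous near g, the shares are 4M for S_n(g - f), T for the uniform error S_n f - f
   integrated over the circle, and 1 for g - f. *)
pose e1 := e / (4 * M + 1 + T); have e10 : 0 < e1 by rewrite divr_gt0//; lra.
have e1E : e1 * (4 * M + 1 + T) = e by rewrite mulfVK//; lra.
have [f [hf gf]] := contT_L1_dense hg e10.
have [N hN] := hu f hf _ e10; exists N => // n /= Nn.
have hgf : L1T (fun t => g t - f t) := L1TB hg (contT_L1 hf).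
have hS h : L1T h -> L1T (S n h) by move=> /(contT_Sfhat ha n)/contT_L1.
pose d := S n (fun t => g t - f t); have hd : L1T d := hS _ hgf.
rewrite sub0r normrN ger0_norm; last by apply: Rintegral_ge0 => t _; exact: cabs_ge0.
have iw := intRD measurable_circle (intRD measurable_circle (intR_nrm1 hd) (contR_int (contR_cst e1))) (intR_nrm1 hgf).
apply: (@le_trans _ _ (nrm1 d + T * e1 + nrm1 (fun t => g t - f t))).
  have -> : T * e1 = \int[leb]_(t in D) e1.
    by rewrite -[X in T * X]mean_cst mulrA mulfV ?gt_eqF// mul1r.
  rewrite /nrm1 -RintegralD; [|exact: measurable_circle|exact: intR_nrm1|exact: (contR_int (contR_cst e1))].
  rewrite -RintegralD; [|exact: measurable_circle| |exact: intR_nrm1]; last first.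
    exact: (intRD measurable_circle (intR_nrm1 hd) (contR_int (contR_cst e1))).
  apply: le_Rintegral => //; first exact: (intR_cabs (L1TB (hS _ hg) hg)).
  move=> t _.
  have -> : S n g t - g t = d t + (S n f t - f t) - (g t - f t).
    rewrite /d (Ssum_fhatB n t hg (contT_L1 hf)).
    by move: (S n g t) (S n f t) (g t) (f t) => x y z w; ring.
  apply: le_trans (cabsD _ _) _; rewrite cabsN lerD ?cabs_le//.
  by apply: le_trans (cabsD _ _) _; rewrite lerD ?cabs_le ?hN.
have h4 := nrm1_Ssum_le M0 hM n hgf.
have : 4 * M * nrm1 (fun t => g t - f t) <= 4 * M * e1 by rewrite ler_wpM2l// mulr_ge0.
rewrite -/d in h4; move: h4 gf; move: (nrm1 d) (nrm1 _) => x y h4 gf h5; lra.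
Qed.

(** Convergent sequences are bounded, and the choice f = e_k reads off a_nk, as S_n e_k (0) = a_nk
    and e_k(0) = 1. *)
Lemma uniform_of_at0 : (forall f, contT f -> ccvg (fun n => S n f 0) (f 0)) -> uniform.
Proof.
move=> h; apply: uniform_of_bounded.
  by apply: bounded_at0 => f hf; exact: ccvg_bounded (h f hf).
move=> k; have := h _ (contT_ek R k); rewrite /ek mulr0 expi0.
by congr ccvg; apply/funext => n; rewrite Ssum_ek// /ek mulr0 expi0 mulr1.
Qed.

Lemma weak_of_strong_L1 :
  (forall g, L1T g -> (fun n => \int[leb]_(t in D) cabs (S n g t - g t)) @ \oo --> (0 : R)) ->
  weak_L1.
Proof.
move=> hs g hg f hf; have [M hM] := contT_bounded hf; have T0 := T_gt0 R.
have M0 : 0 <= M := le_trans (cabs_ge0 _) (hM 0).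
apply/ccvgP => e e0; pose e1 := e / (2 * T^-1 * M + 1).
have c0 : 0 <= 2 * T^-1 * M by rewrite !mulr_ge0// invr_ge0 ltW.
have e10 : 0 < e1 by rewrite divr_gt0//; lra.
have e1E : e1 * (2 * T^-1 * M + 1) = e by rewrite mulfVK//; lra.
have /cvgrPdist_le/(_ _ e10)[N _ hN] := hs g hg; exists N => n Nn.
have h : `|\int[leb]_(t in D) cabs (S n g t - g t)| <= e1.
  by have := hN n Nn; rewrite /= sub0r normrN.
have hS : L1T (S n g) := contT_L1 (contT_Sfhat ha n hg).
have hd : L1T (fun t => S n g t - g t) := L1TB hS hg.
have -> : pairL1 f (S n g) - pairL1 f g = cint (fun t => f (- t) * (S n g t - g t)).
  have L h' : L1T h' -> L1T (fun u => f (- u) * h' u).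
    by move=> h'1; apply: L1T_bounded_mul h'1; exact: contT_opp.
  rewrite /pairL1 -mulN1r addrC -cint_linear; try exact: L.
  by congr cint; apply/funext => u; rewrite mulrBr mulN1r addrC.
apply: le_trans (cint_le (w := fun t => M * cabs (S n g t - g t)) _ _ _) _.
- by apply: L1T_bounded_mul hd; exact: contT_opp.
- exact: (intRZ measurable_circle M (intR_cabs hd)).
- by move=> t _; rewrite cabsM ler_wpM2r ?cabs_ge0.
rewrite RintegralZl; [|exact: measurable_circle|exact: intR_cabs].
have := le_trans (ler_norm _) h; move: (Rintegral _ _ _) => x hx.
have := ler_wpM2l c0 hx; lra.
Qed.

End Equivalences.

Unset Implicit Arguments.

Theorem theorem4p1 (R : realType) (a : nat -> int -> R[i])
  (ha : forall n, abssum (a n)) :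
  [<-> (* (i) weak convergence in C(T) *)
       (forall f, contT f -> forall phi, bdd_lin_functional phi ->
          ccvg (fun n => phi (Ssum a n (fhat f))) (phi f));
       (* (ii) sup-norm convergence *)
       (forall f, contT f -> forall e : R, 0 < e ->
          exists N : nat, forall n, (N <= n)%N -> forall t : R,
            cabs (Ssum a n (fhat f) t - f t) <= e);
       (* (iii) weak* convergence in M(T) *)
       (forall mu : cmeasure R, forall f, contT f ->
          ccvg (fun n => pairL1 f (Ssum a n (muhat mu))) (pairM f mu));
       (* (iv) weak* convergence in M(T) of L^1 functions *)
       (forall g, L1T g -> forall f, contT f ->
          ccvg (fun n => pairL1 f (Ssum a n (fhat g))) (pairL1 f g));
       (* (v) L^1-norm convergence *)
       (forall g, L1T g ->
          (fun n => \int[@lebesgue_measure R]_(t in `[0%R, pi *+ 2])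
                      cabs (Ssum a n (fhat g) t - g t)) @ \oo --> (0 : R))].
Proof.
tfae=> [h|h mu f hf|h|h|h f hf phi hphi].
- by apply: (uniform_of_at0 ha) => f hf; exact: (h f hf _ (blf_eval 0)).
- under eq_fun do rewrite (pairM_dual ha)//.
  exact: (blf_ccvg ha h hf (blf_pairM mu)).
(* The measure with density g is never built: the Dirac mass yields (ii), and the pairing with g is
   then one more bounded functional. *)
- move=> g hg f hf; under eq_fun do rewrite (pairL1_dual ha)//.
  apply: (blf_ccvg ha _ hf (blf_pairL1l hg)).
  apply: (uniform_of_at0 ha) => f' hf'; have := h (delta0 R) f' hf'.
  rewrite pairM_delta0//; congr ccvg; apply/funext => n.
  by rewrite (pairM_dual ha)// pairM_delta0//; exact: (contT_Sfhat ha n (contT_L1 hf')).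
- have hb := weak_L1_bounded ha h.
  exact: (strong_L1 ha hb (uniform_of_bounded ha hb (weak_L1_pointwise h))).
- have hw := weak_of_strong_L1 ha h.
  have hu := uniform_of_bounded ha (weak_L1_bounded ha hw) (weak_L1_pointwise hw).
  exact: (blf_ccvg ha hu hf hphi).
Qed.
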